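(* Let $\mathfrak M,\mathfrak N$ be separable Hilbert spaces, let $\Theta(\lambda)\in \mathbf S(\mathfrak M,\mathfrak N)$, and let $$\tau_0=\left\{\begin{bmatrix}\Gamma_0&C\\ B&A\end{bmatrix};\mathfrak M,\mathfrak N,\mathfrak H\right\}$$ be a simple conservative system with transfer function $\Theta$ (so $\Gamma_0=\Theta(0)$). Let $\{\Gamma_n\}$ and $\{\Theta_n\}$ be the Schur parameters and the Schur iterates of $\Theta$, and let the subspaces $\mathfrak H_{n,m}\subset\mathfrak H$ and operators $A_{n,m}$ be built from $A$ as described in the context. Then, for every $n\ge 1$ for which $\Gamma_n$ is defined: (a) the Schur parameters are given by $$\Gamma_1=D^{-1}_{\Gamma^*_0}C\left(D^{-1}_{\Gamma_0}B^*\right)^*,\qquad \Gamma_2=D^{-1}_{\Gamma^*_1}D^{-1}_{\Gamma^*_0}CA\left(D^{-1}_{\Gamma_1}D^{-1}_{\Gamma_0}\left(B^*\upharpoonright\mathfrak H_{1,0}\right)\right)^*,\ \ldots,$$ $$\Gamma_n=D^{-1}_{\Gamma^*_{n-1}}\cdots D^{-1}_{\Gamma^*_0}CA^{n-1}\left(D^{-1}_{\Gamma_{n-1}}\cdots D^{-1}_{\Gamma_0}\left(B^*\upharpoonright\mathfrak H_{n-1,0}\right)\right)^*,$$ where $\left(D^{-1}_{\Gamma_{n-1}}\cdots D^{-1}_{\Gamma_0}(B^*\upharpoonright\mathfrak H_{n-1,0})\right)^*\in\mathbf L(\mathfrak D_{\Gamma_{n-1}},\mathfrak H_{n-1,0})$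 is the adjoint of the operator $D^{-1}_{\Gamma_{n-1}}\cdots D^{-1}_{\Gamma_0}(B^*\upharpoonright\mathfrak H_{n-1,0})\in\mathbf L(\mathfrak H_{n-1,0},\mathfrak D_{\Gamma_{n-1}})$; (b) $$\operatorname{ran}\left(D^{-1}_{\Gamma_{n-1}}\cdots D^{-1}_{\Gamma_0}\left(B^*\upharpoonright\mathfrak H_{n,0}\right)\right)\subset\operatorname{ran}D_{\Gamma_n},\qquad \operatorname{ran}\left(D^{-1}_{\Gamma^*_{n-1}}\cdots D^{-1}_{\Gamma^*_0}\left(C\upharpoonright\mathfrak H_{0,n}\right)\right)\subset\operatorname{ran}D_{\Gamma^*_n};$$ (c) the systems $$\tau^{(k)}_{n}=\left\{\begin{bmatrix}\Gamma_n&D^{-1}_{\Gamma^*_{n-1}}\cdots D^{-1}_{\Gamma^*_{0}}(CA^{n-k})\\ A^k\left(D^{-1}_{\Gamma_{n-1}}\cdots D^{-1}_{\Gamma_{0}}\left(B^*\upharpoonright\mathfrak H_{n,0}\right)\right)^*&A_{n-k,k}\end{bmatrix};\ \mathfrak D_{\Gamma_{n-1}},\mathfrak D_{\Gamma^*_{n-1}},\mathfrak H_{n-k,k}\right\},\quad k=0,1,\ldots,n,$$ are simple, conservative, pairwise unitarily equivalent (unitarily similar), and each has transfer function equal to the $n$-th Schur iterate $\Theta_n$. Here $\left(D^{-1}_{\Gamma_{n-1}}\cdots D^{-1}_{\Gamma_{0}}(B^*\upharpoonright\mathfrak H_{n,0})\right)^*\in\mathbf L(\mathfrak D_{\Gamma_{n-1}},\mathfrak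 H_{n,0})$ is the adjoint of $D^{-1}_{\Gamma_{n-1}}\cdots D^{-1}_{\Gamma_{0}}(B^*\upharpoonright\mathfrak H_{n,0})\in\mathbf L(\mathfrak H_{n,0},\mathfrak D_{\Gamma_{n-1}})$, and $CA^{n-k}$ is understood as restricted to $\mathfrak H_{n-k,k}$.
   Context: All Hilbert spaces are complex and separable; $\mathbf L(\mathfrak H_1,\mathfrak H_2)$ denotes the bounded operators; $\upharpoonright$ denotes restriction. For a contraction $T\in\mathbf L(\mathfrak H_1,\mathfrak H_2)$: $D_T=(I-T^*T)^{1/2}$, $D_{T^*}=(I-TT^* )^{1/2}$, $\mathfrak D_T=\overline{\operatorname{ran}}\,D_T$, $\mathfrak D_{T^*}=\overline{\operatorname{ran}}\,D_{T^*}$. $D_T^{-1}$ denotes the Moore–Penrose pseudo-inverse of $D_T$, i.e. the inverse of $D_T\upharpoonright\mathfrak D_T$, defined on $\operatorname{ran}D_T$ with values in $\mathfrak D_T$. Schur class: $\mathbf S(\mathfrak M,\mathfrak N)$ is the set of analytic functions $\Theta:\mathbb D\to\mathbf L(\mathfrak M,\mathfrak N)$ with $\|\Theta(\lambda)\|\le1$. Write $\Theta^*(\lambda)=(\Theta(\lambda))^*$. For each $\Theta\in\mathbf S(\mathfrak M,\mathfrak N)$ there is a unique $Z\in\mathbf S(\mathfrak D_{\Theta(0)},\mathfrak D_{\Theta^*(0)})$, with $Z(0)=0$, such that $\Theta(\lambda)=\Theta(0)+D_{\Theta^*(0)}Z(\lambda)(I+\Theta^*(0)Z(\lambda))^{-1}D_{\Theta(0)}$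 on $\mathbb D$; $Z$ is the Möbius parameter of $\Theta$. Schur algorithm: $\Theta_0=\Theta$, $\Gamma_0=\Theta(0)$; given $\Theta_n$ and $\Gamma_n=\Theta_n(0)$, let $Z_{n+1}\in\mathbf S(\mathfrak D_{\Gamma_n},\mathfrak D_{\Gamma_n^*})$ be the Möbius parameter of $\Theta_n$ and put $\Theta_{n+1}(\lambda)=Z_{n+1}(\lambda)/\lambda\in\mathbf S(\mathfrak D_{\Gamma_n},\mathfrak D_{\Gamma_n^*})$, $\Gamma_{n+1}=\Theta_{n+1}(0)$. The $\Gamma_n$ are the Schur parameters and $\Theta_n$ the $n$-th Schur iterate. The algorithm terminates at step $N$ (and $\Gamma_n,\Theta_n$ are defined only for $n\le N$) if $\Gamma_N$ is unitary. Systems: a system $\left\{\begin{bmatrix}D&C\\ B&A\end{bmatrix};\mathfrak M,\mathfrak N,\mathfrak H\right\}$ consists of $D\in\mathbf L(\mathfrak M,\mathfrak N)$, $C\in\mathbf L(\mathfrak H,\mathfrak N)$, $B\in\mathbf L(\mathfrak M,\mathfrak H)$, $A\in\mathbf L(\mathfrak H)$ ($\mathfrak M,\mathfrak N,\mathfrak H$ are the input, output and state spaces). It is conservative if the block operator $\mathfrak M\oplus\mathfrak H\to\mathfrak N\oplus\mathfrak H$ is unitary. Its transfer function is $D+\lambda C(I-\lambda A)^{-1}B$, $\lambda\in\mathbb D$. With $\mathfrak H^c=\overline{\operatorname{span}}\{A^nB\mathfrak M:n\ge0\}$ and $\mathfrak H^o=\overline{\operatorname{span}}\{A^{*n}C^*\mathfrak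 N:n\ge0\}$, the system is simple if $\mathfrak H=\overline{\mathfrak H^c+\mathfrak H^o}$. Two systems with the same $D$ and the same input and output spaces are unitarily similar (equivalent) if there is a unitary $U$ from the first state space onto the second with $A_1=U^{-1}A_2U$, $B_1=U^{-1}B_2$, $C_1=C_2U$. Subspaces: $\mathfrak H_{0,0}=\mathfrak H$, $\mathfrak H_{n,0}=\ker D_{A^n}$, $\mathfrak H_{0,m}=\ker D_{A^{*m}}$, $\mathfrak H_{n,m}=\ker D_{A^n}\cap\ker D_{A^{*m}}$ for $n,m\ge1$; $P_{n,m}$ is the orthogonal projection onto $\mathfrak H_{n,m}$ and $A_{n,m}=P_{n,m}A\upharpoonright\mathfrak H_{n,m}\in\mathbf L(\mathfrak H_{n,m})$. *)

(* Defs.v *)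
From HB Require Import structures.
From mathcomp Require Import all_boot all_order all_algebra.
From mathcomp Require Import sesquilinear.
From mathcomp Require Import all_classical all_reals all_analysis.
From mathcomp Require Export complex.

Set Implicit Arguments.
Unset Strict Implicit.
Unset Printing Implicit Defensive.

Import Order.TTheory GRing.Theory Num.Theory Num.Def.
Import numFieldNormedType.Exports.

Local Open Scope classical_set_scope.
Local Open Scope ring_scope.

Reserved Notation "{ 'bop' H1 -> H2 }"
  (at level 0, H1 at level 98, H2 at level 99,
   format "{ 'bop'  H1  ->  H2 }").
Reserved Notation "S ** T" (at level 40, left associativity, format "S  **  T").

(* Everything is developed over a generic numClosedFieldType C; the scalars of *)
(* the final statement are C = R[i] with R : realType.                        *)

HB.mixin Record isHilbert (C : numClosedFieldType) H
    & CompleteNormedModule C H := {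
  hdot : {dot H for (@conjC C)} ;
  hdotxx : forall x : H, hdot x x = `|x| ^+ 2
}.

#[short(type="hilbertType")]
HB.structure Definition Hilbert (C : numClosedFieldType) :=
  {H of CompleteNormedModule C H & isHilbert C H}.

Definition separable (T : topologicalType) :=
  exists2 S : set T, countable S & dense S.

Section BoundedOperators.
Context {C : numClosedFieldType}.
Implicit Types H : hilbertType C.

Record bop H1 H2 := Bop {
  bop_fun :> H1 -> H2 ;
  bop_linear : linear bop_fun ;
  bop_bounded : exists k : C, forall x, `|bop_fun x| <= k * `|x|
}.

End BoundedOperators.

Notation "{ 'bop' H1 -> H2 }" := (bop H1 H2) : type_scope.

Section BopTheory.
Context {C : numClosedFieldType}.
Implicit Types H : hilbertType C.

HB.instance Definition _ H1 H2 (T : {bop H1 -> H2}) :=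
  GRing.isLinear.Build C H1 H2 *:%R (bop_fun T) (bop_linear T).

Lemma bopP H1 H2 (S T : {bop H1 -> H2}) : S =1 T -> S = T.
Proof.
case: S T => [f lf bf] [g lg bg] /= /funext fg.
by move: lf bf; rewrite fg => lf bf; congr Bop; exact: Prop_irrelevance.
Qed.

Lemma bop_bound_ge0 H1 H2 (T : {bop H1 -> H2}) :
  exists2 k : C, 0 <= k & forall x, `|T x| <= k * `|x|.
Proof.
have [k kT] := bop_bounded T; exists `|k| => // x.
have h := le_trans (normr_ge0 _) (kT x).
by rewrite (le_trans (kT x))// -[leLHS]ger0_norm// normrM normr_id.
Qed.

HB.instance Definition _ H1 H2 := gen_eqMixin {bop H1 -> H2}.
HB.instance Definition _ H1 H2 := gen_choiceMixin {bop H1 -> H2}.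

Fact bop0_linear H1 H2 : linear (fun _ : H1 => 0 : H2).
Proof. by move=> a x y; rewrite scaler0 addr0. Qed.
Fact bop0_bounded H1 H2 :
  exists k : C, forall x : H1, `|0 : H2| <= k * `|x|.
Proof. by exists 0 => x; rewrite normr0 mul0r. Qed.
Definition bop0 H1 H2 := Bop (@bop0_linear H1 H2) (@bop0_bounded H1 H2).

Fact bop_add_linear H1 H2 (S T : {bop H1 -> H2}) :
  linear (fun x => S x + T x).
Proof. by move=> a x y; rewrite !linearP scalerDr addrACA. Qed.
Fact bop_add_bounded H1 H2 (S T : {bop H1 -> H2}) :
  exists k : C, forall x, `|S x + T x| <= k * `|x|.
Proof.
have [[k kS] [l lT]] := (bop_bounded S, bop_bounded T).
by exists (k + l) => x; rewrite mulrDl (le_trans (ler_normD _ _))// lerD.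
Qed.
Definition bop_add H1 H2 (S T : {bop H1 -> H2}) :=
  Bop (bop_add_linear S T) (bop_add_bounded S T).

Fact bop_scale_linear H1 H2 (a : C) (T : {bop H1 -> H2}) :
  linear (fun x => a *: T x).
Proof.
by move=> b x y; rewrite linearP scalerDr !scalerA [a * b]mulrC.
Qed.
Fact bop_scale_bounded H1 H2 (a : C) (T : {bop H1 -> H2}) :
  exists k : C, forall x, `|a *: T x| <= k * `|x|.
Proof.
have [k kT] := bop_bounded T.
by exists (`|a| * k) => x; rewrite normrZ -mulrA ler_wpM2l.
Qed.
Definition bop_scale H1 H2 (a : C) (T : {bop H1 -> H2}) :=
  Bop (bop_scale_linear a T) (bop_scale_bounded a T).

Definition bop_opp H1 H2 (T : {bop H1 -> H2}) := bop_scale (-1) T.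

Fact bop_addA H1 H2 : associative (@bop_add H1 H2).
Proof. by move=> S T U; apply: bopP => x /=; rewrite addrA. Qed.
Fact bop_addC H1 H2 : commutative (@bop_add H1 H2).
Proof. by move=> S T; apply: bopP => x /=; rewrite addrC. Qed.
Fact bop_add0 H1 H2 : left_id (bop0 H1 H2) (@bop_add H1 H2).
Proof. by move=> S; apply: bopP => x /=; rewrite add0r. Qed.
Fact bop_addN H1 H2 : left_inverse (bop0 H1 H2) (@bop_opp H1 H2) (@bop_add H1 H2).
Proof. by move=> S; apply: bopP => x /=; rewrite scaleN1r addNr. Qed.

HB.instance Definition _ H1 H2 := GRing.isZmodule.Build {bop H1 -> H2}
  (@bop_addA H1 H2) (@bop_addC H1 H2) (@bop_add0 H1 H2) (@bop_addN H1 H2).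

Fact bop_scaleA H1 H2 a b (T : {bop H1 -> H2}) :
  bop_scale a (bop_scale b T) = bop_scale (a * b) T.
Proof. by apply: bopP => x /=; rewrite scalerA. Qed.
Fact bop_scale1 H1 H2 : left_id 1 (@bop_scale H1 H2).
Proof. by move=> T; apply: bopP => x /=; rewrite scale1r. Qed.
Fact bop_scaleDr H1 H2 : right_distributive (@bop_scale H1 H2) +%R.
Proof. by move=> a S T; apply: bopP => x /=; rewrite scalerDr. Qed.
Fact bop_scaleDl H1 H2 (T : {bop H1 -> H2}) :
  {morph (@bop_scale H1 H2)^~ T : a b / a + b}.
Proof. by move=> a b; apply: bopP => x /=; rewrite scalerDl. Qed.

HB.instance Definition _ H1 H2 := GRing.Zmodule_isLmodule.Build C {bop H1 -> H2}
  (@bop_scaleA H1 H2) (@bop_scale1 H1 H2) (@bop_scaleDr H1 H2)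
  (@bop_scaleDl H1 H2).

Fact bop1_linear H : linear (fun x : H => x).
Proof. by []. Qed.
Fact bop1_bounded H : exists k : C, forall x : H, `|x| <= k * `|x|.
Proof. by exists 1 => x; rewrite mul1r. Qed.
Definition bop1 H := Bop (@bop1_linear H) (@bop1_bounded H).

Fact bop_comp_linear H1 H2 H3 (S : {bop H2 -> H3}) (T : {bop H1 -> H2}) :
  linear (fun x => S (T x)).
Proof. by move=> a x y; rewrite !linearP. Qed.
Fact bop_comp_bounded H1 H2 H3 (S : {bop H2 -> H3}) (T : {bop H1 -> H2}) :
  exists k : C, forall x, `|S (T x)| <= k * `|x|.
Proof.
have [k k0 kS] := bop_bound_ge0 S; have [l lT] := bop_bounded T.
by exists (k * l) => x; rewrite -mulrA (le_trans (kS _))// ler_wpM2l.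
Qed.
Definition bop_comp H1 H2 H3 (S : {bop H2 -> H3}) (T : {bop H1 -> H2}) :=
  Bop (bop_comp_linear S T) (bop_comp_bounded S T).

Lemma bop_continuous H1 H2 (T : {bop H1 -> H2}) : continuous T.
Proof.
have [k k0 kT] := bop_bound_ge0 T.
have k1 : 0 < k + 1 by rewrite ltr_wpDl.
move=> x; apply/cvgrPdist_le => e e0; near=> y.
rewrite -linearB (le_trans (kT _))//.
apply: (@le_trans _ _ ((k + 1) * `|x - y|)).
  by rewrite ler_wpM2r// lerDl.
rewrite -ler_pdivlMl//; near: y.
apply: cvgr_dist_le; first exact: cvg_id.
by rewrite mulr_gt0 ?invr_gt0.
Unshelve. all: by end_near. Qed.

End BopTheory.

Notation "S ** T" := (bop_comp S T) : ring_scope.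
Arguments bop1 {C} H.

Section Subspaces.
Context {C : numClosedFieldType}.
Implicit Types H : hilbertType C.

Record csub H := CSub {
  csub_set : set H ;
  csub_submod : submod_closed (fun x => x \in csub_set) ;
  csub_closed : closed csub_set
}.

End Subspaces.

Section SubspaceHilbert.
Context {C : numClosedFieldType} {H : hilbertType C} (K : csub H).

Record csub_elt := CSubElt { csub_val : H ; _ : csub_val \in csub_set K }.

HB.instance Definition _ := [isSub for csub_val].
HB.instance Definition _ := [Choice of csub_elt by <:].
HB.instance Definition _ := GRing.SubChoice_isSubLmodule.Build C H
  (fun x => x \in csub_set K) csub_elt
  (GRing.submod_closed_semi (csub_submod K)).

Let sub_norm (x : csub_elt) : C := `|csub_val x|.

Let sub_normD x y : sub_norm (x + y) <= sub_norm x + sub_norm y.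
Proof. exact: ler_normD. Qed.

Let sub_normZ a x : sub_norm (a *: x) = `|a| * sub_norm x.
Proof. exact: normrZ. Qed.

Let sub_norm0 x : sub_norm x = 0 -> x = 0.
Proof. by move=> /normr0_eq0 x0; exact: val_inj. Qed.

HB.instance Definition _ :=
  Lmodule_isNormed.Build C csub_elt sub_normD sub_normZ sub_norm0.

Let sub_complete (F : set_system csub_elt) :
  ProperFilter F -> cauchy F -> cvg F.
Proof.
move=> FF /cauchyP Fc.
pose G := csub_val @ F.
have Gc : cauchy G.
  apply/cauchyP => e /Fc [x Fx]; exists (csub_val x).
  by move: Fx; rewrite -!ball_normE.
have Gl : cvg G by exact: cauchy_cvg.
have Kl : csub_set K (lim G).
  apply: (csub_closed (c := K)) => B /Gl FB.
  have [y By] : exists y, B (csub_val y) by exact: (@filter_ex _ F).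
  by exists (csub_val y); split => //; case: (y) => z /= /set_mem.
apply/cvg_ex; exists (CSubElt (mem_set Kl)).
apply/cvgrPdist_le => e e0.
by have /cvgrPdist_le/(_ e e0) := Gl.
Qed.

HB.instance Definition _ := Uniform_isComplete.Build csub_elt sub_complete.

Definition sub_dot (x y : csub_elt) : C := hdot (csub_val x) (csub_val y).

Let sub_dot_bilinear : bilinear_for *%R (conjC \; *%R) sub_dot.
Proof.
split=> u a x y; rewrite /sub_dot; first by rewrite linearPl.
by rewrite linearPr.
Qed.

Let sub_dot_hermitian x y : sub_dot x y = (-1) ^+ false * conjC (sub_dot y x).
Proof. exact: hermitian_subproof. Qed.

Let sub_dotxx x : sub_dot x x = `|x| ^+ 2.
Proof. exact: hdotxx. Qed.

Let sub_dot_gt0 x : x != 0 -> 0 < sub_dot x x.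
Proof. by move=> x0; rewrite sub_dotxx exprn_gt0// normr_gt0. Qed.

HB.instance Definition _ :=
  bilinear_isBilinear.Build C csub_elt csub_elt C *%R (conjC \; *%R) sub_dot
    sub_dot_bilinear.
HB.instance Definition _ :=
  isHermitianSesquilinear.Build C csub_elt false conjC sub_dot
    sub_dot_hermitian.
HB.instance Definition _ := isDotProduct.Build C csub_elt sub_dot sub_dot_gt0.
HB.instance Definition _ :=
  @isHilbert.Build C csub_elt [the {dot csub_elt for conjC} of sub_dot]
    sub_dotxx.

End SubspaceHilbert.

Definition csub_hilbert (C : numClosedFieldType) (H : hilbertType C)
  (K : csub H) : hilbertType C := csub_elt K.
Coercion csub_hilbert : csub >-> Hilbert.type.

Section Operators.
Context {C : numClosedFieldType}.
Implicit Types H : hilbertType C.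

Fact incl_linear H (K : csub H) : linear (fun x : K => csub_val x).
Proof. by []. Qed.
Fact incl_bounded H (K : csub H) :
  exists k : C, forall x : K, `|csub_val x| <= k * `|x|.
Proof. by exists 1 => x; rewrite mul1r. Qed.
Definition incl H (K : csub H) : {bop K -> H} :=
  Bop (@incl_linear H K) (@incl_bounded H K).

(* The operators below are characterized uniquely by the predicate given to   *)
(* xget; the default 0 is never used for proj and adj, nor for psqrt T when   *)
(* T is positive, nor for inv T when T is invertible.                         *)

(* The orthogonal projection onto K, as an operator with values in K. *)
Definition proj H (K : csub H) : {bop H -> K} :=
  xget 0 [set P : {bop H -> K} |
    forall x (y : K), hdot (x - incl K (P x)) (incl K y) = 0].

Definition adj H1 H2 (T : {bop H1 -> H2}) : {bop H2 -> H1} :=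
  xget 0 [set S : {bop H2 -> H1} | forall x y, hdot (T x) y = hdot x (S y)].

Definition inverse_of H1 H2 (T : {bop H1 -> H2}) (S : {bop H2 -> H1}) :=
  S ** T = bop1 H1 /\ T ** S = bop1 H2.

Definition invertible H1 H2 (T : {bop H1 -> H2}) := exists S, inverse_of T S.

Definition inv H1 H2 (T : {bop H1 -> H2}) : {bop H2 -> H1} :=
  xget 0 [set S | inverse_of T S].

Definition psqrt H (T : {bop H -> H}) : {bop H -> H} :=
  xget 0 [set S : {bop H -> H} | (forall x, 0 <= hdot (S x) x) /\ S ** S = T].

Definition pow H (T : {bop H -> H}) (n : nat) : {bop H -> H} :=
  iter n (bop_comp T) (bop1 H).

Definition defect H1 H2 (T : {bop H1 -> H2}) : {bop H1 -> H1} :=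
  psqrt (bop1 H1 - adj T ** T).

Fact closure_submod H (A : set H) :
  submod_closed (fun x => x \in A) -> submod_closed (fun x => x \in closure A).
Proof.
move=> [A0 Alin]; split; first by apply/mem_set/subset_closure/set_mem.
move=> a x y /set_mem Ax /set_mem Ay; apply/mem_set => B.
have c : (fun z : H * H => a *: z.1 + z.2) z @[z --> (x, y)] --> a *: x + y.
  by apply: cvgD; [apply: cvgZr; exact: cvg_fst|exact: cvg_snd].
move=> /c [[B1 B2] /= [/Ax [u [Au Bu]] /Ay [v [Av Bv]]] sB].
exists (a *: u + v); split; last exact: (sB (u, v)).
by apply/set_mem/Alin; exact/mem_set.
Qed.

Fact range_submod H1 H2 (T : {bop H1 -> H2}) :
  submod_closed (fun x => x \in range T).
Proof.
split; first by apply/mem_set; exists 0; rewrite ?linear0.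
move=> a _ _ /set_mem [x _ <-] /set_mem [y _ <-]; apply/mem_set.
by exists (a *: x + y); rewrite ?linearP.
Qed.

Definition defect_space H1 H2 (T : {bop H1 -> H2}) : csub H1 :=
  CSub (closure_submod (range_submod (defect T))) (@closed_closure _ _).

Fact ker_submod H1 H2 (T : {bop H1 -> H2}) :
  submod_closed (fun x => x \in [set x | T x = 0]).
Proof.
split; first by apply/mem_set; rewrite /= linear0.
move=> a x y /set_mem /= Tx /set_mem /= Ty; apply/mem_set => /=.
by rewrite linearP /= Tx Ty scaler0 addr0.
Qed.

Fact ker_closed H1 H2 (T : {bop H1 -> H2}) : closed [set x | T x = 0].
Proof.
apply: (@closed_comp _ _ T [set 0]); first by move=> x _; exact: bop_continuous.
exact/accessible_closed_set1/hausdorff_accessible/norm_hausdorff.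
Qed.

Definition ker H1 H2 (T : {bop H1 -> H2}) : csub H1 :=
  CSub (ker_submod T) (@ker_closed _ _ T).

Fact setT_submod H : submod_closed (fun x : H => x \in [set: H]).
Proof. by split; [|move=> a x y _ _]; rewrite inE. Qed.

Definition csubT H : csub H := CSub (@setT_submod H) (@closedT H).

Fact setI_submod H (K L : csub H) :
  submod_closed (fun x => x \in csub_set K `&` csub_set L).
Proof.
have [K0 Kl] := csub_submod K; have [L0 Ll] := csub_submod L.
split; first by rewrite classical_sets.in_setI K0.
by move=> a x y; rewrite !classical_sets.in_setI => /andP[? ?] /andP[? ?]; rewrite Kl ?Ll.
Qed.

Definition csubI H (K L : csub H) : csub H :=
  CSub (setI_submod K L) (closedI (csub_closed (c := K)) (csub_closed (c := L))).

End Operators.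

Section Unitarity.
Context {C : numClosedFieldType}.
Implicit Types (H M N : hilbertType C) (X Y : Type).

Definition unitary_wrt X Y (dX : X -> X -> C) (dY : Y -> Y -> C) (f : X -> Y) :=
  (forall x x', dY (f x) (f x') = dX x x') /\ (forall y, exists x, f x = y).

Definition unitary H1 H2 (T : {bop H1 -> H2}) := unitary_wrt hdot hdot T.

(* The library norm on M * H is the max norm, so the orthogonal sum of M and  *)
(* H is given by its inner product on the carrier M * H.                      *)
Definition dsum_dot M H (u v : M * H) : C := hdot u.1 v.1 + hdot u.2 v.2.

End Unitarity.

Section SchurClass.
Context {C : numClosedFieldType}.
Implicit Types (H M N : hilbertType C) (l : C).

(* A function on the unit disk is a function on C of which only the values on *)
(* the unit disk matter.                                                      *)
Definition analytic_on_disk M N (Th : C -> {bop M -> N}) :=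
  forall l, `|l| < 1 -> exists T' : {bop M -> N},
    forall e : C, 0 < e -> exists2 d : C, 0 < d &
      forall l', `|l'| < 1 -> `|l' - l| < d ->
        forall x, `|(Th l' - Th l - (l' - l) *: T') x| <= e * `|l' - l| * `|x|.

Definition schur_class M N (Th : C -> {bop M -> N}) :=
  analytic_on_disk Th /\ forall l, `|l| < 1 -> forall x, `|Th l x| <= `|x|.

(* [proj _ ** adj G ** incl _] is G^* as an operator between the defect       *)
(* spaces; it is a restriction since G^* maps one defect space to the other.  *)
Definition is_moebius_parameter M N (Th : C -> {bop M -> N})
    (Z : C -> {bop defect_space (Th 0) -> defect_space (adj (Th 0))}) :=
  let G := Th 0 in
  let W l := bop1 (defect_space G)
    + (proj (defect_space G) ** adj G ** incl (defect_space (adj G))) ** Z l in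
  [/\ schur_class Z, Z 0 = 0 &
      forall l, `|l| < 1 -> invertible (W l) /\
        Th l = G + (defect (adj G) ** incl (defect_space (adj G))) ** Z l
                   ** inv (W l) ** (proj (defect_space G) ** defect G)].

Definition moebius_parameter M N (Th : C -> {bop M -> N}) :
    C -> {bop defect_space (Th 0) -> defect_space (adj (Th 0))} :=
  xget (fun=> 0) [set Z | is_moebius_parameter Z].

(* Z(l) / l at l != 0, extended analytically to 0. *)
Definition schur_next M N (Th : C -> {bop M -> N}) :
    C -> {bop defect_space (Th 0) -> defect_space (adj (Th 0))} :=
  xget (fun=> 0) [set Th1 | schur_class Th1 /\
    forall l, `|l| < 1 -> l != 0 -> Th1 l = l^-1 *: moebius_parameter Th l].

(* The spaces change at each step, so an iterate is bundled with its spaces. *)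
Record opfun := OpFun {
  opfun_in : hilbertType C ;
  opfun_out : hilbertType C ;
  opfun_val : C -> {bop opfun_in -> opfun_out}
}.

Definition schur_step (F : opfun) : opfun := OpFun (schur_next (opfun_val F)).

Definition schur_iter M N (Th : C -> {bop M -> N}) (n : nat) : opfun :=
  iter n schur_step (OpFun Th).

Definition schur_in M N (Th : C -> {bop M -> N}) n : hilbertType C :=
  opfun_in (schur_iter Th n).
Definition schur_out M N (Th : C -> {bop M -> N}) n : hilbertType C :=
  opfun_out (schur_iter Th n).

Definition schur_iterate M N (Th : C -> {bop M -> N}) n :
    C -> {bop schur_in Th n -> schur_out Th n} :=
  opfun_val (schur_iter Th n).

Definition schur_param M N (Th : C -> {bop M -> N}) n :
    {bop schur_in Th n -> schur_out Th n} :=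
  schur_iterate Th n 0.

Definition schur_defined M N (Th : C -> {bop M -> N}) n :=
  forall k, (k < n)%N -> ~ unitary (schur_param Th k).

End SchurClass.

(* Unbounded, partially defined operators are represented by their graphs:    *)
(* [G x y] means that x is in the domain and is sent to y.                    *)
Section Graphs.
Context {C : numClosedFieldType}.
Implicit Types (H M N : hilbertType C).

Definition defect_pinv M N (T : {bop M -> N}) : M -> defect_space T -> Prop :=
  fun z y => defect T (incl _ y) = z.

(* D_{Gamma_(n-1)}^-1 ... D_{Gamma_0}^-1 *)
Fixpoint dinv_in M N (Th : C -> {bop M -> N}) n : M -> schur_in Th n -> Prop :=
  match n return M -> schur_in Th n -> Prop with
  | 0 => fun x y => x = y
  | n'.+1 => fun x y =>
      exists2 z, @dinv_in M N Th n' x z & defect_pinv (T := schur_param Th n') z y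
  end.

(* D_{Gamma_(n-1)^*}^-1 ... D_{Gamma_0^*}^-1 *)
Fixpoint dinv_out M N (Th : C -> {bop M -> N}) n : N -> schur_out Th n -> Prop :=
  match n return N -> schur_out Th n -> Prop with
  | 0 => fun x y => x = y
  | n'.+1 => fun x y =>
      exists2 z, @dinv_out M N Th n' x z &
        defect_pinv (T := adj (schur_param Th n')) z y
  end.

Definition has_graph H1 H2 (T : {bop H1 -> H2}) (G : H1 -> H2 -> Prop) :=
  forall x, G x (T x).

End Graphs.

Arguments defect_pinv {C M N} T _ _.
Arguments dinv_in {C M N} Th n _ _.
Arguments dinv_out {C M N} Th n _ _.

Section Systems.
Context {C : numClosedFieldType}.
Implicit Types (H M N : hilbertType C).

Record system M N H := System {
  sysD : {bop M -> N} ;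
  sysC : {bop H -> N} ;
  sysB : {bop M -> H} ;
  sysA : {bop H -> H}
}.

Definition block_op M N H (s : system M N H) (u : M * H) : N * H :=
  (sysD s u.1 + sysC s u.2, sysB s u.1 + sysA s u.2).

Definition conservative M N H (s : system M N H) :=
  unitary_wrt (@dsum_dot C M H) (@dsum_dot C N H) (block_op s).

Definition transfer M N H (s : system M N H) (l : C) : {bop M -> N} :=
  sysD s + l *: (sysC s ** inv (bop1 H - l *: sysA s) ** sysB s).

Definition has_transfer M N H (s : system M N H) (Th : C -> {bop M -> N}) :=
  forall l, `|l| < 1 -> Th l = transfer s l.

Definition lspan H (S : set H) : set H :=
  [set x | exists (n : nat) (c : 'I_n -> C) (u : 'I_n -> H),
    (forall i, S (u i)) /\ x = \sum_(i < n) c i *: u i].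

Definition controllable_space M N H (s : system M N H) : set H :=
  closure (lspan [set x | exists n m, x = pow (sysA s) n (sysB s m)]).

Definition observable_space M N H (s : system M N H) : set H :=
  closure (lspan [set x | exists n y, x = pow (adj (sysA s)) n (adj (sysC s) y)]).

Definition simple_system M N H (s : system M N H) :=
  closure [set x + y | x in controllable_space s & y in observable_space s]
  = [set: H].

Definition unitarily_similar M N H1 H2
    (s1 : system M N H1) (s2 : system M N H2) :=
  sysD s1 = sysD s2 /\
  exists U : {bop H1 -> H2}, unitary U /\
    [/\ sysA s1 = inv U ** sysA s2 ** U,
        sysB s1 = inv U ** sysB s2 &
        sysC s1 = sysC s2 ** U].

Definition Hnm H (A : {bop H -> H}) (n m : nat) : csub H :=
  match n, m with
  | 0, 0 => csubT H
  | _.+1, 0 => ker (defect (pow A n))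
  | 0, _.+1 => ker (defect (pow (adj A) m))
  | _.+1, _.+1 => csubI (ker (defect (pow A n))) (ker (defect (pow (adj A) m)))
  end.

Definition Anm H (A : {bop H -> H}) n m : {bop Hnm A n m -> Hnm A n m} :=
  proj (Hnm A n m) ** A ** incl (Hnm A n m).

End Systems.

Section SchurSystems.
Context {C : numClosedFieldType}.
Implicit Types (H M N : hilbertType C).

(* D_{Gamma_(n-1)}^-1 ... D_{Gamma_0}^-1 (B^* restricted to H_{m,0}) *)
Definition in_graph M N H (Th : C -> {bop M -> N}) (s : system M N H) n m :
    Hnm (sysA s) m 0 -> schur_in Th n -> Prop :=
  fun x y => dinv_in Th n (adj (sysB s) (incl _ x)) y.

(* D_{Gamma_(n-1)^*}^-1 ... D_{Gamma_0^*}^-1 (C A^p restricted to H_{m,q}) *)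
Definition out_graph M N H (Th : C -> {bop M -> N}) (s : system M N H) n p m q :
    Hnm (sysA s) m q -> schur_out Th n -> Prop :=
  fun x y => dinv_out Th n (sysC s (pow (sysA s) p (incl _ x))) y.

(* t is the system tau_n^(k); since the pseudo-inverses are single-valued,    *)
(* these conditions determine t.                                              *)
Definition is_tau M N H (Th : C -> {bop M -> N}) (s : system M N H) n k
    (t : system (schur_in Th n) (schur_out Th n) (Hnm (sysA s) (n - k) k)) :=
  [/\ sysD t = schur_param Th n,
      has_graph (sysC t) (@out_graph _ _ _ Th s n (n - k) (n - k) k),
      exists2 F : {bop Hnm (sysA s) n 0 -> schur_in Th n},
        has_graph F (@in_graph _ _ _ Th s n n) &
        forall y, incl _ (sysB t y) = pow (sysA s) k (incl _ (adj F y)) &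
      sysA t = Anm (sysA s) (n - k) k].

End SchurSystems.

Arguments in_graph {C M N H} Th s n m _ _.
Arguments out_graph {C M N H} Th s n p m q _ _.

(* Main.v *)
(* Let s = [D C; B A] be conservative and simple, with transfer function      *)
(* Theta. Unitarity gives B^* B = D_G^2 and C C^* = D_{G^*}^2 for             *)
(* G = Theta(0), so that B = X^* D_G and C = D_{G^*} Y with co-isometries X   *)
(* and Y onto the defect spaces, and A = - X^* G^* Y + A P where P projects   *)
(* onto ker C = ker D_A. Thus A arises from A P by a feedback, which turns    *)
(* Z(l) = l Y (1 - l A P)^-1 X^* into the Moebius parameter of Theta. Hence   *)
(* Theta_1 = Z / l is the transfer function of the system                     *)
(* [Y X^*, Y A; P X^*, P A] on ker D_A, which is again conservative and       *)
(* simple, and iterating yields tau_n^(0) on ker D_{A^n}. Finally A^k maps    *)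
(* H_{n,0} unitarily onto H_{n-k,k} and carries tau_n^(0) to tau_n^(k).       *)
From mathcomp Require Import all_boot all_order all_algebra.
From mathcomp Require Import sesquilinear.
From mathcomp Require Import all_classical all_reals all_analysis.
From mathcomp Require Import ring.
Require Import Defs.

Set Implicit Arguments.
Unset Strict Implicit.
Unset Printing Implicit Defensive.

Import Order.TTheory GRing.Theory Num.Theory Num.Def.
Import numFieldNormedType.Exports.

Local Open Scope classical_set_scope.
Local Open Scope ring_scope.

(** The Schur algorithm is run on the system rather than on the function. Unitarity makes |B m| =
    |D_G m|, and dually for C, so co-isometries X and Y split off ([defect_factor]): B^* = D_G X and
    C = D_{G^*} Y, that is, X and Y are D_G^{-1} B^* and D_{G^*}^{-1} C. The other unitarity
    relations present A as a feedback around A P, with P the projection onto ker C ([step_A]).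
    Solving the feedback equation exhibits the Möbius parameter as the transfer function of
    [moebius_sys], and removing the factor l realizes the next iterate by [step_sys] on ker C
    ([schur_step_system]). Both functions are defined by choice, so [moebius_unique] and
    [schur_class_punctured] are needed to identify them.

    After n steps the state space is H_{n,0} and ker C is H_{n+1,0} ([Hnm_incl_range]), so induction
    ([schur_realizationS]) yields tau_n^(0), one pseudo-inverse being added at each step. Claim (a)
    is the feedthrough Y X^* of the last step, claim (b) is the factorization through defect
    operators in realizations of Theta_n, and claim (c) holds since A^k is unitary from H_{n,0} onto
    H_{n-k,k} ([transport_tau]). *)

Local Notation "''[' x , y ]" := (hdot x y) : ring_scope.

(** * Inner products and operators *)

Section InnerProduct.
Context {C : numClosedFieldType}.
Implicit Types H : hilbertType C.

Lemma hdotC H (x y : H) : '[x, y] = conjC '[y, x].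
Proof. by rewrite hermC mul1r. Qed.

Lemma hdotDl H (x y z : H) : '[x + y, z] = '[x, z] + '[y, z].
Proof. exact: linearDl. Qed.

Lemma hdotDr H (x y z : H) : '[z, x + y] = '[z, x] + '[z, y].
Proof. exact: linearDr. Qed.

Lemma hdotNl H (x z : H) : '[- x, z] = - '[x, z].
Proof. exact: linearNl. Qed.

Lemma hdotNr H (x z : H) : '[z, - x] = - '[z, x].
Proof. exact: linearNr. Qed.

Lemma hdotBl H (x y z : H) : '[x - y, z] = '[x, z] - '[y, z].
Proof. by rewrite hdotDl hdotNl. Qed.

Lemma hdotBr H (x y z : H) : '[z, x - y] = '[z, x] - '[z, y].
Proof. by rewrite hdotDr hdotNr. Qed.

Lemma hdotZl H a (x z : H) : '[a *: x, z] = a * '[x, z].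
Proof. by rewrite linearZl_LR. Qed.

Lemma hdotZr H a (x z : H) : '[z, a *: x] = conjC a * '[z, x].
Proof. by rewrite linearZr_LR. Qed.

Lemma hdot0l H (z : H) : '[0, z] = 0.
Proof. exact: linear0l. Qed.

Lemma hdot0r H (z : H) : '[z, 0] = 0.
Proof. exact: linear0r. Qed.

Lemma hdot_eq0C H (x y : H) : '[x, y] = 0 -> '[y, x] = 0.
Proof. by move=> xy0; rewrite hdotC xy0 conjC0. Qed.

Lemma hdotxx_eq0 H (x : H) : '[x, x] = 0 -> x = 0.
Proof. by rewrite hdotxx => /eqP; rewrite expf_eq0 normr_eq0 => /eqP. Qed.

Lemma hdotxx_ge0 H (x : H) : 0 <= '[x, x].
Proof. by rewrite hdotxx exprn_ge0. Qed.

Lemma hdot_extr H (x y : H) : (forall z, '[z, x] = '[z, y]) -> x = y.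
Proof.
move=> xy; apply/eqP; rewrite -subr_eq0; apply/eqP/hdotxx_eq0.
by rewrite hdotBr xy subrr.
Qed.

Lemma hdot_extl H (x y : H) : (forall z, '[x, z] = '[y, z]) -> x = y.
Proof. by move=> xy; apply: hdot_extr => z; rewrite hdotC xy -hdotC. Qed.

Lemma bop_dotP H1 H2 (S T : {bop H1 -> H2}) :
  (forall x y, '[S x, y] = '[T x, y]) -> S = T.
Proof. by move=> ST; apply: bopP => x; apply: hdot_extl. Qed.

(** Pythagoras for the component of [x] orthogonal to [y]. It yields Cauchy-Schwarz and, later, the
    orthogonality of a nearest point. *)
Lemma sqr_norm_sub_line H (x y : H) : y != 0 ->
  `|x - ('[x, y] / `|y| ^+ 2) *: y| ^+ 2
    = `|x| ^+ 2 - `|'[x, y]| ^+ 2 / `|y| ^+ 2.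
Proof.
move=> y0; rewrite -2!hdotxx hdotBl !hdotBr !hdotZl !hdotZr hdotxx hdotxx.
rewrite (hdotC y x) normCK rmorphM fmorphV rmorphXn /= (geC0_conj (normr_ge0 y)).
have : `|y| != 0 by rewrite normr_eq0.
move: `|x| `|y| '[x, y] (conjC '[x, y]) => a b c d b0; field; exact: b0.
Qed.

Lemma cauchy_schwarz H (x y : H) : `|'[x, y]| <= `|x| * `|y|.
Proof.
have [->|y0] := eqVneq y 0; first by rewrite hdot0r !normr0 mulr0.
have := exprn_ge0 2 (normr_ge0 (x - ('[x, y] / `|y| ^+ 2) *: y)).
rewrite sqr_norm_sub_line// subr_ge0 ler_pdivrMr ?exprn_gt0 ?normr_gt0//.
by rewrite -exprMn ler_sqr ?nnegrE ?mulr_ge0.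
Qed.

Lemma sqr_normD H (x y : H) :
  `|x + y| ^+ 2 = `|x| ^+ 2 + `|y| ^+ 2 + ('[x, y] + conjC '[x, y]).
Proof. by rewrite -!hdotxx hdotDl !hdotDr (hdotC y x); ring. Qed.

Lemma parallelogram H (x y : H) :
  `|x + y| ^+ 2 + `|x - y| ^+ 2 = 2 * (`|x| ^+ 2 + `|y| ^+ 2).
Proof. by rewrite !sqr_normD hdotNr normrN rmorphN /=; ring. Qed.

(** Polarization: norms determine the real part of the inner product, and replacing [x] by ['i *: x]
    gives the imaginary part. *)
Lemma isometry_dot H1 H2 (T : {bop H1 -> H2}) :
  (forall x, `|T x| = `|x|) -> forall x y, '[T x, T y] = '[x, y].
Proof.
move=> isoT.
have re x y : '[T x, T y] + conjC '[T x, T y] = '[x, y] + conjC '[x, y].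
  have := sqr_normD (T x) (T y); rewrite -linearD !isoT sqr_normD.
  by move=> /addrI ->.
move=> x y.
have r1 := re x y.
have := re ('i *: x) y; rewrite linearZ /= !hdotZl !rmorphM /= conjCi.
rewrite !mulNr -!mulrBr => /(mulfI (neq0Ci _)) r2.
have e (a b : C) : (a + b) + (a - b) = a *+ 2 by ring.
by apply: (pmulrnI (isT : (0 < 2)%N)); rewrite -(e _ (conjC '[T x, T y])) r1 r2 e.
Qed.

Lemma bopD H1 H2 (T : {bop H1 -> H2}) x y : T (x + y) = T x + T y.
Proof. exact: linearD. Qed.

Lemma bopN H1 H2 (T : {bop H1 -> H2}) x : T (- x) = - T x.
Proof. exact: linearN. Qed.

Lemma bopB H1 H2 (T : {bop H1 -> H2}) x y : T (x - y) = T x - T y.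
Proof. exact: linearB. Qed.

Lemma bopZ H1 H2 (T : {bop H1 -> H2}) a x : T (a *: x) = a *: T x.
Proof. exact: linearZ. Qed.

Lemma bop_0 H1 H2 (T : {bop H1 -> H2}) : T 0 = 0.
Proof. exact: linear0. Qed.

Lemma bop_addE H1 H2 (S T : {bop H1 -> H2}) x : (S + T) x = S x + T x.
Proof. by []. Qed.

Lemma bop_subE H1 H2 (S T : {bop H1 -> H2}) x : (S - T) x = S x - T x.
Proof. by rewrite -[in RHS]scaleN1r. Qed.

End InnerProduct.

Section Completeness.
Context {R : realType}.
Local Notation C := R[i].
Implicit Types H : hilbertType C.

(** A positive element of the partially ordered [R[i]] is real, so the Archimedean property of [R]
    applies to epsilons taken in [C]. *)
Lemma complexR_gt0 (e : C) : 0 < e -> exists2 r : R, 0 < r & e = real_complex R r.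
Proof.
case: e => a b; rewrite ltcE /= => /andP[/eqP -> a0]; by exists a.
Qed.

Lemma archi_inv_lt (e : C) : 0 < e -> exists n : nat, n.+1%:R^-1 < e.
Proof.
move=> /complexR_gt0[r r0 ->].
exists (Num.bound r^-1).
have b := archi_boundP (ltW (x := 0) (y := r^-1) _).
rewrite -(rmorph_nat (real_complex R)) -fmorphV ltcR invf_plt ?posrE//.
by rewrite (lt_le_trans (b _)) ?invr_gt0// ler_nat.
Qed.

Lemma cauchy_rate H (u : nat -> H) (eps : nat -> C) :
  (forall n m, (n <= m)%N -> `|u m - u n| <= eps n) ->
  (forall e : C, 0 < e -> exists n, eps n <= e) ->
  exists2 l, u n @[n --> \oo] --> l & forall n, `|l - u n| <= eps n.
Proof.
move=> ule epsle.
have /cvg_ex[l ul] : cvg (u n @[n --> \oo]).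
  apply: cauchy_cvg; apply/cauchyP => e e0.
  have [n ne] := epsle (e / 2) (divr_gt0 e0 (ltr0n _ 2)).
  exists (u n); rewrite -ball_normE; exists n => // m /= nm.
  rewrite distrC (le_lt_trans (ule _ _ nm))// (le_lt_trans ne)//.
  by rewrite ltr_pdivrMr// ltr_pMr// ltr1n.
exists l => // n; apply/ler_addgt0Pr => e e0.
have /cvgrPdist_le/(_ e e0)[N _ uN] := ul.
have -> : l - u n = (u (maxn n N) - u n) + (l - u (maxn n N)).
  by rewrite [RHS]addrC addrA subrK.
rewrite (le_trans (ler_normD _ _))// lerD ?ule ?leq_maxl//.
by apply: uN => /=; rewrite leq_maxr.
Qed.

Lemma le0_of_eps (a b : C) : 0 <= b -> (forall e : C, 0 < e -> a <= e * b) -> a <= 0.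
Proof.
move=> b0 ab; apply/ler_addgt0Pr => e e0; rewrite add0r.
have b1 : 0 < b + 1 by rewrite ltr_wpDl.
rewrite (le_trans (ab (e / (b + 1)) _)) ?divr_gt0//.
by rewrite -mulrA ler_piMr ?(ltW e0)// mulrC ler_pdivrMr// mul1r lerDl.
Qed.

Lemma eq0_of_eps H (x : H) (b : C) :
  0 <= b -> (forall e : C, 0 < e -> `|x| <= e * b) -> x = 0.
Proof. by move=> b0 /(le0_of_eps b0); rewrite normr_le0 => /eqP. Qed.

(** Completeness of the bounded operators, phrased without an operator norm: the pointwise limit is
    linear because the rate is uniform on the unit ball. *)
Lemma bop_limit H1 H2 (T : nat -> {bop H1 -> H2}) (eps : nat -> C) :
  (forall n m x, (n <= m)%N -> `|T m x - T n x| <= eps n * `|x|) ->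
  (forall e : C, 0 < e -> exists n, eps n <= e) ->
  exists L : {bop H1 -> H2}, forall n x, `|L x - T n x| <= eps n * `|x|.
Proof.
move=> Tle epsle.
have cv x : exists l, forall n, `|l - T n x| <= eps n * `|x|.
  have [||l _ lT] := @cauchy_rate _ (fun n => T n x) (fun n => eps n * `|x|).
  - by move=> n m nm; apply: Tle.
  - move=> e e0; have x1 : 0 < `|x| + 1 by rewrite ltr_wpDl.
    have [n ne] := epsle (e / (`|x| + 1)) (divr_gt0 e0 x1).
    exists n; rewrite (le_trans (ler_wpM2r _ ne))//.
    by rewrite -mulrA ler_piMr ?(ltW e0)// mulrC ler_pdivrMr// mul1r lerDl.
  - by exists l.
have [L Lp] := choice cv.
have Llin : linear L.
  move=> a x y; apply/eqP; rewrite -subr_eq0; apply/eqP.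
  apply: (@eq0_of_eps _ _ (`|a *: x + y| + (`|a| * `|x| + `|y|))).
    by rewrite !addr_ge0 ?mulr_ge0.
  move=> e /epsle[n ne].
  have -> : L (a *: x + y) - (a *: L x + L y) =
      (L (a *: x + y) - T n (a *: x + y))
      - (a *: (L x - T n x) + (L y - T n y)).
    by rewrite bopD bopZ scalerBr (addrACA (a *: L x)) -opprD opprB [RHS]addrA subrK.
  rewrite (le_trans (ler_normB _ _))// mulrDr lerD//.
    by rewrite (le_trans (Lp _ n))// ler_wpM2r.
  rewrite (le_trans (ler_normD _ _))// mulrDr lerD//.
    by rewrite normrZ mulrCA ler_wpM2l// (le_trans (Lp _ n))// ler_wpM2r.
  by rewrite (le_trans (Lp _ n))// ler_wpM2r.
have [n0 _] := epsle 1 ltr01.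
have [k kT] := bop_bounded (T n0).
have Lbd : exists k : C, forall x, `|L x| <= k * `|x|.
  exists (eps n0 + k) => x; rewrite -[L x](subrK (T n0 x)).
  by rewrite (le_trans (ler_normD _ _))// mulrDl lerD.
by exists (Bop Llin Lbd) => n x; apply: Lp.
Qed.

End Completeness.

(** * Orthogonal projections and adjoints *)

Section Projection.
Context {R : realType}.
Local Notation C := R[i].
Implicit Types H : hilbertType C.

Lemma csub_set0 H (K : csub H) : csub_set K 0.
Proof. by have [/set_mem] := csub_submod K. Qed.

Lemma csub_setP H (K : csub H) a x y :
  csub_set K x -> csub_set K y -> csub_set K (a *: x + y).
Proof.
by have [_ Kl] := csub_submod K => Kx Ky; apply/set_mem/Kl; apply/mem_set.
Qed.

Lemma csub_setZ H (K : csub H) a x : csub_set K x -> csub_set K (a *: x).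
Proof. by move=> Kx; rewrite -[_ *: _]addr0; apply: csub_setP => //; exact: csub_set0. Qed.

Lemma csub_setD H (K : csub H) x y :
  csub_set K x -> csub_set K y -> csub_set K (x + y).
Proof. by move=> Kx Ky; rewrite -[x]scale1r; exact: csub_setP. Qed.

Lemma csub_valP H (K : csub H) (x : K) : csub_set K (incl K x).
Proof. by case: x => x /= /set_mem. Qed.

Definition csub_in H (K : csub H) x (Kx : csub_set K x) : K :=
  CSubElt (mem_set Kx).

Lemma incl_inj H (K : csub H) : injective (incl K).
Proof. by move=> x y; exact: val_inj. Qed.

Lemma incl_dot H (K : csub H) (x y : K) : '[incl K x, incl K y] = '[x, y].
Proof. by []. Qed.

Lemma incl_norm H (K : csub H) (x : K) : `|incl K x| = `|x|.
Proof. by []. Qed.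

(** Midpoints of a minimizing sequence stay in [K], so the parallelogram law bounds the distance of
    two terms by their excess over the infimum, and the sequence is Cauchy. *)
Lemma nearest_point H (K : csub H) x :
  exists2 y, csub_set K y & forall z, csub_set K z -> `|x - y| <= `|x - z|.
Proof.
pose E := [set complex.Re (`|x - y| ^+ 2) | y in csub_set K].
have ReE y : real_complex R (complex.Re (`|x - y| ^+ 2)) = `|x - y| ^+ 2.
  by apply: RRe_real; apply: ger0_real; exact: exprn_ge0.
have Elb : has_inf E.
  split; first by exists (complex.Re (`|x - 0| ^+ 2)); exists 0 => //; exact: csub_set0.
  by exists 0 => _ [y _ <-]; rewrite -lecR ReE exprn_ge0.
pose D := real_complex R (inf E).
have DK y : csub_set K y -> D <= `|x - y| ^+ 2.
  move=> Ky; rewrite -ReE lecR; apply: ge_inf; first by case: Elb.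
  by exists y.
have exy n : exists y, csub_set K y /\ `|x - y| ^+ 2 <= D + n.+1%:R^-1.
  have n0 : 0 < (n.+1%:R^-1 : R) by rewrite invr_gt0.
  have [_ [y Ky <-]] := inf_adherent n0 Elb => /ltW yn.
  exists y; split=> //; rewrite -ReE -(rmorph_nat (real_complex R)) -fmorphV.
  by rewrite -rmorphD lecR.
have [y yP] := choice exy.
have yK n : csub_set K (y n) by case: (yP n).
have yD n : `|x - y n| ^+ 2 <= D + n.+1%:R^-1 by case: (yP n).
have dist n m : (n <= m)%N -> `|y m - y n| ^+ 2 <= 4 / n.+1%:R.
  move=> nm; have := parallelogram (x - y n) (x - y m).
  have -> : x - y n - (x - y m) = y m - y n by rewrite opprB addrC addrA subrK.
  have -> : x - y n + (x - y m) = 2 *: (x - 2^-1 *: (y n + y m)).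
    rewrite scalerBr scalerA divff ?pnatr_eq0// scale1r scaler_nat mulr2n.
    by rewrite opprD addrACA.
  have /DK : csub_set K (2^-1 *: (y n + y m)).
    by apply: csub_setZ; apply: csub_setD.
  rewrite normrZ exprMn ger0_norm// => Dm /(canRL (addKr _)) ->.
  have mn : (m.+1%:R^-1 : C) <= n.+1%:R^-1.
    by rewrite lef_pV2 ?posrE// ler_nat.
  have {}yDm : `|x - y m| ^+ 2 <= D + n.+1%:R^-1.
    by rewrite (le_trans (yD m))// lerD2l.
  have := yD n; move: Dm yDm.
  move: (`|_| ^+ 2) (`|_| ^+ 2) (`|_| ^+ 2) (n.+1%:R^-1 : C) => b c a e.
  rewrite -subr_ge0 -[c <= _]subr_ge0 -[b <= _]subr_ge0 => a0 c0 b0.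
  rewrite -subr_ge0.
  have -> : 4 * e - (- (2 ^+ 2 * a) + 2 * (b + c)) =
     4 * (a - D) + 2 * (D + e - b) + 2 * (D + e - c) by ring.
  by rewrite !addr_ge0 ?mulr_ge0.
(* [2 * s n] is the square root of the bound [4 / n.+1%:R] in [dist]. *)
pose s n : C := sqrtC n.+1%:R^-1.
have s0 n : 0 <= s n by rewrite sqrtC_ge0 invr_ge0.
have slim (e : C) : 0 < e -> exists n, s n <= e.
  move=> e0; have [n ne] := archi_inv_lt (exprn_gt0 2 e0).
  exists n; rewrite -ler_sqr ?nnegrE ?(ltW e0)//.
  by rewrite sqrtCK ltW.
have [||l yl ly] := @cauchy_rate R H y (fun n => 2 * s n).
- move=> n m nm; rewrite -ler_sqr ?nnegrE ?mulr_ge0//.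
  by rewrite exprMn sqrtCK -natrX dist.
- move=> e e0; have [n ne] := slim _ (divr_gt0 e0 (ltr0n _ 2)).
  by exists n; rewrite mulrC -ler_pdivlMr.
have Kl : csub_set K l.
  by apply: (closed_cvg _ (csub_closed (c := K)) _ _ yl); exact: nearW.
exists l => // z Kz; apply/ler_addgt0Pr => e e0.
have [n ne] := slim _ (divr_gt0 e0 (ltr0n _ 3)).
have h : `|x - y n| <= `|x - z| + s n.
  rewrite -ler_sqr ?nnegrE ?addr_ge0// sqrrD sqrtCK.
  rewrite (le_trans (yD n))// lerD2r ler_wpDr ?mulrn_wge0 ?mulr_ge0//.
  exact: DK.
have -> : x - l = (x - y n) - (l - y n) by rewrite opprB [RHS]addrA subrK.
rewrite (le_trans (ler_normB _ _))// (le_trans (lerD h (ly n)))// -addrA lerD2l.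
have -> : s n + 2 * s n = 3 * s n by ring.
by rewrite mulrC -ler_pdivlMr.
Qed.

(** Moving from [y] by [c *: z] would lower the squared distance by |<x - y, z>|^2 / |z|^2, so this
    amount is 0. *)
Lemma nearest_point_orth H (K : csub H) x y :
  csub_set K y -> (forall z, csub_set K z -> `|x - y| <= `|x - z|) ->
  forall z, csub_set K z -> '[x - y, z] = 0.
Proof.
move=> Ky ymin z Kz; have [->|z0] := eqVneq z 0; first by rewrite hdot0r.
set c := '[x - y, z] / `|z| ^+ 2.
have := ymin (y + c *: z).
rewrite opprD addrA => /(_ (csub_setD Ky (csub_setZ _ Kz))).
rewrite -ler_sqr ?nnegrE// sqr_norm_sub_line// -subr_ge0 addrAC subrr add0r.
rewrite oppr_ge0 pmulr_lle0 ?invr_gt0 ?exprn_gt0 ?normr_gt0//.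
by move=> c0; apply/normr0_eq0/eqP; rewrite -sqrf_eq0 eq_le c0 exprn_ge0.
Qed.

Lemma proj_exists H (K : csub H) : exists P : {bop H -> K},
  forall x (y : K), '[x - incl K (P x), incl K y] = 0.
Proof.
have exy x : exists p : K, forall y : K, '[x - incl K p, incl K y] = 0.
  have [y Ky ymin] := nearest_point K x.
  exists (csub_in Ky) => z.
  exact: (nearest_point_orth Ky ymin (csub_valP z)).
have [P Pp] := choice exy.
have Plin : linear P.
  move=> a x y; apply: hdot_extl => z.
  have := Pp (a *: x + y) z; have := Pp x z; have := Pp y z.
  rewrite !hdotBl !hdotDl !hdotZl !incl_dot.
  by move=> /subr0_eq -> /subr0_eq -> /subr0_eq ->.
have Pbd : exists k : C, forall x, `|P x| <= k * `|x|.
  exists 1 => x; rewrite mul1r.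
  have := Pp x (P x); rewrite hdotBl incl_dot hdotxx => /subr0_eq e.
  have [->|p0] := eqVneq (P x) 0; first by rewrite normr0.
  rewrite -(ler_pM2r (_ : 0 < `|P x|)) ?normr_gt0// -expr2 -e.
  rewrite -[leLHS]ger0_norm ?e ?exprn_ge0// -e.
  exact: le_trans (cauchy_schwarz _ _) _.
by exists (Bop Plin Pbd).
Qed.

Lemma projP H (K : csub H) x (y : K) : '[x - incl K (proj K x), incl K y] = 0.
Proof.
exact: (xgetPex 0 (proj_exists K) x y).
Qed.

Lemma proj_dot H (K : csub H) x (y : K) : '[proj K x, y] = '[x, incl K y].
Proof.
by apply/esym/eqP; rewrite -subr_eq0 -incl_dot -hdotBl projP.
Qed.

Lemma proj_incl H (K : csub H) (x : K) : proj K (incl K x) = x.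
Proof. by apply: hdot_extl => z; rewrite proj_dot. Qed.

Lemma incl_proj H (K : csub H) x : csub_set K x -> incl K (proj K x) = x.
Proof. by move=> Kx; rewrite -[x]/(incl K (csub_in Kx)) proj_incl. Qed.

Lemma csub_full H (K : csub H) :
  (forall x, (forall y, csub_set K y -> '[x, y] = 0) -> x = 0) ->
  csub_set K = [set: H].
Proof.
move=> K0; apply/seteqP; split=> // x _.
have /subr0_eq -> : x - incl K (proj K x) = 0.
  by apply: K0 => y Ky; rewrite -[y]/(incl K (csub_in Ky)) projP.
exact: csub_valP.
Qed.

Lemma closed_eps H (A : set H) :
  (forall x, (forall e : C, 0 < e -> exists2 y, A y & `|x - y| < e) -> A x) ->
  closed A.
Proof.
move=> Aeps x clx; apply: Aeps => e e0.
by have [y [Ay]] := clx _ (nbhsx_ballx x e e0); rewrite -ball_normE; exists y.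
Qed.

Lemma closure_eps H (A : set H) x : closure A x ->
  forall e : C, 0 < e -> exists2 y, A y & `|x - y| < e.
Proof.
move=> clx e e0.
by have [y [Ay]] := clx _ (nbhsx_ballx x e e0); rewrite -ball_normE; exists y.
Qed.

(** Let [w] be the component orthogonal to the kernel [K] of some [x0] with [f x0 != 0]. As
    [x - (f x / f w) *: w] lies in [K], it is orthogonal to [w], which makes [f] the inner product
    with a multiple of [w]. *)
Lemma riesz H (f : H -> C) (k : C) :
  (forall a x y, f (a *: x + y) = a * f x + f y) ->
  (forall x, `|f x| <= k * `|x|) -> exists z, forall x, f x = '[x, z].
Proof.
move=> flin fbd.
have f0 : f 0 = 0.
  by have := flin (-1) 0 0; rewrite scaler0 addr0 mulN1r addNr.
have fZ a x : f (a *: x) = a * f x by rewrite -[_ *: _]addr0 flin f0 addr0.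
have fB x y : f (x - y) = f x - f y by rewrite addrC -scaleN1r flin mulN1r addrC.
have submodK : submod_closed (fun x => x \in [set x | f x = 0]).
  split; first by rewrite inE.
  by move=> a x y /set_mem /= fx /set_mem /= fy; rewrite inE /= flin fx fy mulr0 addr0.
have closedK : closed [set x | f x = 0].
  apply: closed_eps => x xe /=.
  apply/eqP; rewrite -normr_le0; apply: (@le0_of_eps _ _ `|k|) => // e e0.
  have [y fy xy] := xe e e0.
  rewrite -[f x]subr0 -fy -fB (le_trans (fbd _))//.
  have k0 : k * `|x - y| <= `|k| * `|x - y|.
    rewrite -[leLHS]ger0_norm ?normrM ?normr_id//.
    exact: le_trans (normr_ge0 _) (fbd _).
  by rewrite (le_trans k0)// mulrC ler_wpM2r// ltW.
pose K := CSub submodK closedK.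
have [f00|/existsNP[x0 /eqP fx0]] := pselect (forall x, f x = 0).
  by exists 0 => x; rewrite hdot0r.
pose w := x0 - incl K (proj K x0).
have fw : f w = f x0 by rewrite fB (csub_valP (proj K x0)) subr0.
have w0 : w != 0 by apply: contra_neq fx0 => w0; rewrite -fw w0.
exists ((conjC (f w) / `|w| ^+ 2) *: w) => x.
have Ky : csub_set K (x - (f x / f w) *: w).
  by rewrite /= fB fZ mulfVK ?subrr// fw.
have /hdot_eq0C := projP x0 (csub_in Ky); rewrite /= -/w.
rewrite hdotBl hdotZl hdotxx => /subr0_eq e.
rewrite hdotZr e rmorphM fmorphV rmorphXn /= conjCK (geC0_conj (normr_ge0 w)).
have fw0 : f w != 0 by rewrite fw.
have n0 : `|w| != 0 by rewrite normr_eq0.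
move: (f w) (f x) `|w| fw0 n0 => a b c a0 c0.
by rewrite [_ * c ^+ 2]mulrC mulrA divfK ?expf_neq0// mulrCA divff// mulr1.
Qed.

Lemma adj_exists H1 H2 (T : {bop H1 -> H2}) : exists S : {bop H2 -> H1},
  forall x y, '[T x, y] = '[x, S y].
Proof.
have [k k0 kT] := bop_bound_ge0 T.
have exy y : exists z, forall x, '[T x, y] = '[x, z].
  apply: (@riesz _ _ (k * `|y|)) => [a x z|x].
    by rewrite bopD bopZ hdotDl hdotZl.
  by rewrite mulrAC (le_trans (cauchy_schwarz _ _))// ler_wpM2r.
have [S Sp] := choice exy.
have Slin : linear S.
  move=> a x y; apply: hdot_extr => z.
  by rewrite -Sp hdotDr hdotZr !Sp hdotDr hdotZr.
have Sbd : exists k : C, forall x, `|S x| <= k * `|x|.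
  exists k => x; have [->|s0] := eqVneq (S x) 0.
    by rewrite normr0 mulr_ge0.
  rewrite -(ler_pM2r (_ : 0 < `|S x|)) ?normr_gt0//.
  rewrite -expr2 -hdotxx -Sp -[leLHS]ger0_norm ?Sp ?hdotxx_ge0// -Sp.
  by rewrite (le_trans (cauchy_schwarz _ _))// mulrAC ler_wpM2r.
by exists (Bop Slin Sbd) => x y; apply: Sp.
Qed.

Lemma adjP H1 H2 (T : {bop H1 -> H2}) x y : '[T x, y] = '[x, adj T y].
Proof.
exact: (xgetPex 0 (adj_exists T) x y).
Qed.

Lemma adjPl H1 H2 (T : {bop H1 -> H2}) x y : '[adj T y, x] = '[y, T x].
Proof. by rewrite hdotC -adjP -hdotC. Qed.

Lemma adj_unique H1 H2 (T : {bop H1 -> H2}) (S : {bop H2 -> H1}) :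
  (forall x y, '[T x, y] = '[x, S y]) -> adj T = S.
Proof. by move=> TS; apply: bop_dotP => y x; rewrite adjPl hdotC -hdotC [RHS]hdotC -TS -hdotC. Qed.

Lemma adjK H1 H2 (T : {bop H1 -> H2}) : adj (adj T) = T.
Proof. by apply: adj_unique => x y; rewrite adjPl. Qed.

Lemma adj_comp H1 H2 H3 (S : {bop H2 -> H3}) (T : {bop H1 -> H2}) :
  adj (S ** T) = adj T ** adj S.
Proof. by apply: adj_unique => x y /=; rewrite -!adjP. Qed.

Lemma adj_proj H (K : csub H) : adj (proj K) = incl K.
Proof. by apply: adj_unique => x y; rewrite proj_dot. Qed.

Lemma adj_contraction H1 H2 (T : {bop H1 -> H2}) :
  (forall x, `|T x| <= `|x|) -> forall x, `|adj T x| <= `|x|.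
Proof.
move=> T1 x; have [->|s0] := eqVneq (adj T x) 0; first by rewrite normr0.
rewrite -(ler_pM2r (_ : 0 < `|adj T x|)) ?normr_gt0//.
have e : `|adj T x| ^+ 2 = `|'[T (adj T x), x]|.
  by rewrite adjP hdotxx ger0_norm ?exprn_ge0.
by rewrite -expr2 e (le_trans (cauchy_schwarz _ _))// mulrC ler_wpM2l.
Qed.

End Projection.

(** * Resolvents and positive square roots *)

Section Resolvent.
Context {R : realType}.
Local Notation C := R[i].
Implicit Types H : hilbertType C.

Definition contractive H1 H2 (T : {bop H1 -> H2}) := forall x, `|T x| <= `|x|.

(** This is (n+1) q^n <= 1 + q + ... + q^n multiplied by 1 - q; it shows that q^n tends to 0 through
    the Archimedean property. *)
Lemma geom_bound (q : C) n : 0 <= q -> q < 1 ->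
  n.+1%:R * (q ^+ n * (1 - q)) <= 1 - q ^+ n.+1.
Proof.
move=> q0 q1; elim: n => [|n IHn]; first by rewrite expr0 mul1r mul1r expr1.
have -> : n.+2%:R * (q ^+ n.+1 * (1 - q)) =
    q * (n.+1%:R * (q ^+ n * (1 - q))) + q ^+ n.+1 * (1 - q).
  by rewrite -natr1 exprS; ring.
rewrite (le_trans (lerD (ler_wpM2l q0 IHn) (lexx _)))//.
rewrite -subr_ge0.
have -> : 1 - q ^+ n.+2 - (q * (1 - q ^+ n.+1) + q ^+ n.+1 * (1 - q)) =
    (1 - q) * (1 - q ^+ n.+1) by rewrite !exprS; ring.
by rewrite mulr_ge0 ?subr_ge0 ?exprn_ile1// ltW.
Qed.

Lemma geom_small (q e : C) : 0 <= q -> q < 1 -> 0 < e ->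
  exists n, q ^+ n / (1 - q) <= e.
Proof.
move=> q0 q1 e0; have q1' : 0 < 1 - q by rewrite subr_gt0.
have [n ne] := archi_inv_lt (mulr_gt0 e0 (exprn_gt0 2 q1')).
exists n; rewrite ler_pdivrMr//.
rewrite -(ler_pM2r q1') -mulrA -expr2 (le_trans _ (ltW ne))//.
rewrite -[leRHS]mul1r ler_pdivlMr// mulrC (le_trans (geom_bound _ _ _))//.
by rewrite gerBl exprn_ge0.
Qed.

(** Neumann series: [T n] is the sum of (l A)^j over j < n, and its limit satisfies L = 1 + l A L,
    so [L] is a right inverse. It is also a left inverse because 1 - l A is injective. *)
Lemma resolvent_exists H (A : {bop H -> H}) (l : C) : contractive A ->
  `|l| < 1 -> invertible (bop1 H - l *: A).
Proof.
move=> A1 l1; have l1' : 0 < 1 - `|l| by rewrite subr_gt0.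
have n0 : 1 - `|l| != 0 by rewrite gt_eqF.
pose T := fix T n : {bop H -> H} :=
  if n is m.+1 then bop1 H + l *: (A ** T m) else 0.
have TS n x : T n.+1 x = x + l *: A (T n x) by [].
have TB n x : `|T n x| <= (1 - `|l|)^-1 * `|x|.
  elim: n => [|n IHn]; first by rewrite normr0 mulr_ge0 ?invr_ge0 ?(ltW l1').
  rewrite TS (le_trans (ler_normD _ _))//.
  have -> : (1 - `|l|)^-1 * `|x| = `|x| + `|l| * ((1 - `|l|)^-1 * `|x|).
    by rewrite mulrA -[X in _ = X + _]mul1r -mulrDl; congr (_ * _); rewrite -[LHS]mul1r -[X in X * _ = _](subrK `|l|) mulrDl divff.
  by rewrite lerD2l normrZ ler_wpM2l// (le_trans (A1 _)).
have TC n k x : `|T (n + k)%N x - T n x| <= `|l| ^+ n / (1 - `|l|) * `|x|.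
  elim: n => [|n IHn]; first by rewrite subr0 expr0 mul1r.
  rewrite addSn !TS opprD addrACA subrr add0r -scalerBr -bopB normrZ exprS -!mulrA.
  by rewrite ler_wpM2l// (le_trans (A1 _))// mulrA.
have [||L Lp] := @bop_limit R H H T (fun n => `|l| ^+ n / (1 - `|l|)).
- by move=> n m x nm; rewrite -(subnKC nm).
- by move=> e e0; apply: geom_small.
have fix_eq (S : {bop H -> H}) x (b : C) : 0 <= b ->
  (forall n, `|S x| <= `|l| ^+ n / (1 - `|l|) * b) -> S x = 0.
  move=> b0 Sb; apply: (eq0_of_eps b0) => e e0.
  have [n ne] := geom_small (normr_ge0 l) l1 e0.
  by rewrite (le_trans (Sb n))// ler_wpM2r.
have decr n : `|l| ^+ n.+1 / (1 - `|l|) <= `|l| ^+ n / (1 - `|l|).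
  by rewrite ler_wpM2r ?invr_ge0 ?(ltW l1')// exprS ler_piMl ?exprn_ge0 ?(ltW l1).
have LE x : L x = x + l *: A (L x).
  apply/eqP; rewrite -subr_eq0; apply/eqP.
  rewrite -[LHS](bop_subE L (bop1 H + l *: (A ** L))).
  apply: (fix_eq (L - (bop1 H + l *: (A ** L))) x (2 * `|x|)) => [|n].
    by rewrite mulr_ge0.
  have -> : (L - (bop1 H + l *: (A ** L))) x = (L x - T n.+1 x) + l *: A (T n x - L x).
    by rewrite bop_subE TS bopB scalerBr addrA !opprD !addrA subrK.
  rewrite (le_trans (ler_normD _ _))// mulr_natl mulr2n mulrDr lerD//.
    by rewrite (le_trans (Lp _ _))// ler_wpM2r.
  rewrite normrZ; apply: (@le_trans _ _ (1 * `|T n x - L x|)).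
    by rewrite ler_pM ?(ltW l1) ?A1.
  by rewrite mul1r distrC.
have inj x : x = l *: A x -> x = 0.
  move=> xE; apply/normr0_eq0/eqP; rewrite eq_le normr_ge0 andbT.
  rewrite -(pmulr_rle0 _ l1') mulrBl mul1r subr_le0 {1}xE normrZ.
  by rewrite ler_wpM2l.
exists L; split; apply: bopP => x /=; last first.
  by rewrite scaleN1r {1}LE addrK.
rewrite scaleN1r; set z := L _.
have zE : z = x - l *: A x + l *: A z by exact: LE.
apply/eqP; rewrite -subr_eq0; apply/eqP/inj.
by rewrite bopB scalerBr {1}zE addrC !addrA addNr add0r addrC.
Qed.

End Resolvent.

Section SquareRoot.
Context {R : realType}.
Local Notation C := R[i].
Implicit Types H : hilbertType C.

Definition selfadjoint H (T : {bop H -> H}) := forall x y, '[T x, y] = '[x, T y].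

(** Complex polarization: the form at x + y and at i x + y gives both the sum and the difference of
    <T x, y> and <T y, x>. *)
Lemma qform_eq0 H (T : {bop H -> H}) : (forall x, '[T x, x] = 0) -> T = 0.
Proof.
move=> T0.
have sk x y : '[T x, y] + '[T y, x] = 0.
  have := T0 (x + y); rewrite bopD hdotDl !hdotDr !T0 add0r addr0.
  by rewrite addrC addrC.
apply: bop_dotP => x y; rewrite hdot0l.
have s1 := sk x y; have := sk ('i *: x) y.
rewrite bopZ hdotZl hdotZr conjCi mulNr -mulrBr => /eqP.
rewrite mulf_eq0 (negPf (neq0Ci _)) /= subr_eq0 => /eqP s2.
move: s1; rewrite -s2 -mulr2n => /eqP.
by rewrite mulrn_eq0 /= => /eqP.
Qed.

Lemma positive_selfadjoint H (T : {bop H -> H}) :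
  (forall x, 0 <= '[T x, x]) -> selfadjoint T.
Proof.
move=> T0 x y.
have /subr0_eq TE : T - adj T = 0.
  apply: qform_eq0 => z; rewrite bop_subE hdotBl adjPl.
  by rewrite [X in _ - X]hdotC (CrealP _) ?subrr// ger0_real.
by rewrite {1}TE adjPl.
Qed.

(* The root of [1 - A] is [1 - L] with [L] the limit of the iteration         *)
(* [Y |-> (A + Y^2) / 2] started at 0.                                        *)
Definition sqrt_step H (A Y : {bop H -> H}) : {bop H -> H} :=
  (2^-1 : C) *: (A + Y ** Y).

Definition sqrt_seq H (A : {bop H -> H}) n : {bop H -> H} := iter n (sqrt_step A) 0.

(* The iteration at the scalar 1: it dominates the norms of the terms of      *)
(* [sqrt_seq] and of their differences.                                       *)
Fixpoint sqrt_maj n : C := if n is m.+1 then (1 + sqrt_maj m ^+ 2) / 2 else 0.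

Lemma sqrt_maj_bounds n : 0 <= sqrt_maj n <= 1.
Proof.
elim: n => [|n /andP[n0 n1]] /=; first by rewrite lexx ler01.
rewrite divr_ge0 ?addr_ge0 ?exprn_ge0//= ler_pdivrMr// mul1r.
by rewrite -[2](natrD _ 1 1) lerD2l exprn_ile1.
Qed.

Lemma sqrt_maj_ge0 n : 0 <= sqrt_maj n.
Proof. by case/andP: (sqrt_maj_bounds n). Qed.

Lemma sqrt_maj_le1 n : sqrt_maj n <= 1.
Proof. by case/andP: (sqrt_maj_bounds n). Qed.

(** The gap d = 1 - [sqrt_maj n] evolves by d |-> d (2 - d) / 2, which increases on [0, 1] and sends
    2 / (n+2) to at most 2 / (n+3). *)
Lemma sqrt_maj_rate n : 1 - sqrt_maj n <= 2 / n.+2%:R.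
Proof.
elim: n => [|n IHn]; first by rewrite subr0 divff ?pnatr_eq0.
set d := 1 - sqrt_maj n in IHn.
have d0 : 0 <= d by rewrite subr_ge0 sqrt_maj_le1.
have d1 : d <= 1 by rewrite gerBl sqrt_maj_ge0.
have -> : 1 - sqrt_maj n.+1 = d * (2 - d) / 2.
  by rewrite /d /=; field.
set f : C := 2 / n.+2%:R in IHn.
have f1 : f <= 1 by rewrite ler_pdivrMr// mul1r ler_nat.
apply: (@le_trans _ _ (f * (2 - f) / 2)).
  rewrite ler_wpM2r ?invr_ge0// -subr_ge0.
  have -> : f * (2 - f) - d * (2 - d) = (f - d) * ((1 - f) + (1 - d)) by ring.
  by apply: mulr_ge0; rewrite ?[_ <= f - d]subr_ge0// addr_ge0 ?subr_ge0.
rewrite -subr_ge0 /f.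
have -> : 2 / n.+3%:R - 2 / n.+2%:R * (2 - 2 / n.+2%:R) / 2 =
   2 / (n.+3%:R * n.+2%:R ^+ 2) :> C.
  have n2 : n.+2%:R != 0 :> C by rewrite pnatr_eq0.
  have n3 : n.+3%:R != 0 :> C by rewrite pnatr_eq0.
  have e3 : n.+3%:R = n.+2%:R + 1 :> C by rewrite natr1.
  rewrite e3 in n3 *; move: (n.+2%:R : C) n2 n3 => a a0 a1.
  by field; apply/andP.
by rewrite divr_ge0 ?mulr_ge0 ?exprn_ge0.
Qed.

Lemma sqrt_maj_small (e : C) : 0 < e -> exists n, 1 - sqrt_maj n <= e.
Proof.
move=> e0; have [n ne] := archi_inv_lt (divr_gt0 e0 (ltr0n _ 2)).
exists n; rewrite (le_trans (sqrt_maj_rate n))//.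
rewrite mulrC -ler_pdivlMr// (le_trans _ (ltW ne))//.
by rewrite lef_pV2 ?posrE// ler_nat.
Qed.

Lemma sqrt_maj_homo n : sqrt_maj n <= sqrt_maj n.+1.
Proof.
rewrite -subr_ge0 /=.
have -> : (1 + sqrt_maj n ^+ 2) / 2 - sqrt_maj n = (1 - sqrt_maj n) ^+ 2 / 2 by field.
by rewrite divr_ge0 ?exprn_ge0// subr_ge0 sqrt_maj_le1.
Qed.

Lemma sqrt_maj_incr n k : 0 <= sqrt_maj (n + k) - sqrt_maj n.
Proof.
rewrite subr_ge0; elim: k => [|k IHk]; first by rewrite addn0.
by rewrite addnS (le_trans IHk)// sqrt_maj_homo.
Qed.

Section Construction.
Variables (H : hilbertType C) (A : {bop H -> H}) (A1 : contractive A).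

Lemma sqrt_seqS n x :
  sqrt_seq A n.+1 x = 2^-1 *: (A x + sqrt_seq A n (sqrt_seq A n x)).
Proof. by []. Qed.

Lemma half_norm (x : H) : `|(2^-1 : C) *: x| = `|x| / 2.
Proof. by rewrite normrZ ger0_norm ?invr_ge0// mulrC. Qed.

Lemma sqrt_seq_bound n x : `|sqrt_seq A n x| <= sqrt_maj n * `|x|.
Proof.
elim: n x => [|n IHn] x; first by rewrite /= normr0 mul0r.
rewrite sqrt_seqS half_norm /= mulrAC ler_wpM2r ?invr_ge0//.
rewrite (le_trans (ler_normD _ _))// mulrDl mul1r lerD//.
by rewrite expr2 -mulrA (le_trans (IHn _))// ler_wpM2l ?sqrt_maj_ge0.
Qed.

(** Rests on Y'^2 - Y^2 = Y' (Y' - Y) + (Y' - Y) Y; the same identity in the scalar recursion gives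
    the majorant. *)
Lemma sqrt_seq_cauchy n k x :
  `|sqrt_seq A (n + k) x - sqrt_seq A n x|
    <= (sqrt_maj (n + k) - sqrt_maj n) * `|x|.
Proof.
elim: n x => [|n IHn] x; first by rewrite /= !subr0 sqrt_seq_bound.
rewrite addSn !sqrt_seqS -scalerBr half_norm opprD addrACA subrr add0r.
set Yk := sqrt_seq A (n + k); set Y := sqrt_seq A n in IHn *.
have -> : Yk (Yk x) - Y (Y x) = Yk (Yk x - Y x) + (Yk (Y x) - Y (Y x)).
  by rewrite bopB addrA subrK.
have -> : sqrt_maj (n + k).+1 - sqrt_maj n.+1 =
   (sqrt_maj (n + k) * (sqrt_maj (n + k) - sqrt_maj n)
    + (sqrt_maj (n + k) - sqrt_maj n) * sqrt_maj n) / 2 by rewrite /=; field.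
rewrite [leRHS]mulrAC ler_wpM2r ?invr_ge0// (le_trans (ler_normD _ _))//.
rewrite mulrDl lerD//.
  rewrite (le_trans (sqrt_seq_bound _ _))// -mulrA.
  by rewrite ler_wpM2l ?sqrt_maj_ge0.
rewrite (le_trans (IHn _))// -mulrA ler_wpM2l ?sqrt_seq_bound//.
exact: sqrt_maj_incr.
Qed.

Lemma sqrt_limit_exists : exists L : {bop H -> H},
  forall n x, `|L x - sqrt_seq A n x| <= (1 - sqrt_maj n) * `|x|.
Proof.
apply: bop_limit => [n m x nm|]; last exact: sqrt_maj_small.
rewrite -(subnKC nm) (le_trans (sqrt_seq_cauchy _ _ _))// ler_wpM2r//.
by rewrite lerD2r sqrt_maj_le1.
Qed.

Variables (L : {bop H -> H}).
Hypothesis LP : forall n x, `|L x - sqrt_seq A n x| <= (1 - sqrt_maj n) * `|x|.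

Lemma sqrt_limit_contraction : contractive L.
Proof. by move=> x; have := LP 0 x; rewrite /= !subr0 mul1r. Qed.

Lemma eps_maj_eq H' (x : H') (b : C) : 0 <= b ->
  (forall n, `|x| <= (1 - sqrt_maj n) * b) -> x = 0.
Proof.
move=> b0 xb; apply: (eq0_of_eps b0) => e e0; have [n ne] := sqrt_maj_small e0.
by rewrite (le_trans (xb n))// ler_wpM2r.
Qed.

Lemma sqrt_limit_eq x : L x = 2^-1 *: (A x + L (L x)).
Proof.
apply/eqP; rewrite -subr_eq0; apply/eqP.
apply: (@eps_maj_eq _ _ (2 * `|x|)) => [|n]; first by rewrite mulr_ge0.
set Y := sqrt_seq A n.
have -> : L x - 2^-1 *: (A x + L (L x)) =
    (L x - sqrt_seq A n.+1 x) + 2^-1 *: (Y (Y x - L x) + (Y (L x) - L (L x))).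
  have -> : Y (Y x - L x) + (Y (L x) - L (L x)) = A x + Y (Y x) - (A x + L (L x)).
    by rewrite bopB addrA subrK opprD addrACA subrr add0r.
  by rewrite scalerBr sqrt_seqS addrA subrK.
rewrite (le_trans (ler_normD _ _))// mulr_natl mulr2n mulrDr lerD//.
  by rewrite (le_trans (LP _ _))// ler_wpM2r// lerD2l lerN2 sqrt_maj_homo.
rewrite half_norm ler_pdivrMr// (le_trans (ler_normD _ _))//.
rewrite mulr_natr mulr2n lerD//.
  rewrite (le_trans (sqrt_seq_bound _ _))// distrC.
  by rewrite -[leRHS]mul1r; apply: ler_pM; rewrite ?sqrt_maj_ge0 ?sqrt_maj_le1 ?LP.
rewrite distrC (le_trans (LP _ _))// ler_wpM2l ?subr_ge0 ?sqrt_maj_le1//.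
exact: sqrt_limit_contraction.
Qed.

Lemma sqrt_limit_sq x : L (L x) = L x *+ 2 - A x.
Proof.
rewrite [in RHS]sqrt_limit_eq -scaler_nat scalerA divff ?pnatr_eq0// scale1r.
by rewrite addrC addKr.
Qed.

Lemma sqrt_limit_selfadjoint : selfadjoint A -> selfadjoint L.
Proof.
move=> Asa; have Ysa n : selfadjoint (sqrt_seq A n).
  elim: n => [|n IHn] x y; first by rewrite hdot0l hdot0r.
  rewrite !sqrt_seqS hdotZl hdotZr hdotDl hdotDr Asa !IHn.
  by rewrite geC0_conj ?invr_ge0.
move=> x y; apply/eqP; rewrite -subr_eq0 -normr_le0.
apply: (@le0_of_eps _ _ (2 * (`|x| * `|y|))) => [|e e0]; first by rewrite !mulr_ge0.
have [n ne] := sqrt_maj_small e0.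
have LYe z : `|L z - sqrt_seq A n z| <= e * `|z|.
  by rewrite (le_trans (LP _ _))// ler_wpM2r.
have -> : '[L x, y] - '[x, L y] =
    '[L x - sqrt_seq A n x, y] - '[x, L y - sqrt_seq A n y].
  by rewrite hdotBl hdotBr Ysa opprB addrA subrK.
rewrite (le_trans (ler_normB _ _))// mulr_natl mulr2n mulrDr lerD//.
  by rewrite (le_trans (cauchy_schwarz _ _))// mulrA ler_wpM2r.
by rewrite (le_trans (cauchy_schwarz _ _))// mulrCA ler_wpM2l.
Qed.

End Construction.

(** [K] intertwines the iterates, which are polynomials in [A1] and [A2], hence their limits. It
    serves for the commutation in [sqrt_unique] and for D_{T^*} T = T D_T. *)
Lemma sqrt_limit_intertwine H1 H2 (A1 L1 : {bop H1 -> H1})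
    (A2 L2 : {bop H2 -> H2}) (K : {bop H1 -> H2}) :
  (forall n x, `|L1 x - sqrt_seq A1 n x| <= (1 - sqrt_maj n) * `|x|) ->
  (forall n x, `|L2 x - sqrt_seq A2 n x| <= (1 - sqrt_maj n) * `|x|) ->
  (forall x, A2 (K x) = K (A1 x)) -> forall x, L2 (K x) = K (L1 x).
Proof.
move=> L1P L2P AK; have YK n x : sqrt_seq A2 n (K x) = K (sqrt_seq A1 n x).
  by elim: n x => [|n IHn] x; rewrite ?bop_0// !sqrt_seqS bopZ bopD AK !IHn.
move=> x; have [k k0 Kk] := bop_bound_ge0 K.
apply/eqP; rewrite -subr_eq0; apply/eqP.
apply: (@eps_maj_eq _ _ (`|K x| + k * `|x|)) => [|n].
  by rewrite addr_ge0 ?mulr_ge0.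
have -> : L2 (K x) - K (L1 x) =
    (L2 (K x) - sqrt_seq A2 n (K x)) - K (L1 x - sqrt_seq A1 n x).
  by rewrite YK bopB opprB addrA subrK.
rewrite (le_trans (ler_normB _ _))// mulrDr lerD//.
by rewrite (le_trans (Kk _))// mulrCA ler_wpM2l.
Qed.

Lemma sqrt_limit_root H (A L : {bop H -> H}) : contractive A ->
  (forall n x, `|L x - sqrt_seq A n x| <= (1 - sqrt_maj n) * `|x|) ->
  forall x, (bop1 H - L) ((bop1 H - L) x) = x - A x.
Proof.
move=> A1 LP x; rewrite !bop_subE (bopB L) /= (sqrt_limit_sq A1 LP) mulr2n opprB.
by rewrite [_ - A x]addrAC addrK addrA subrK.
Qed.

Lemma sqrt_limit_ge0 H (A L : {bop H -> H}) : contractive A -> selfadjoint A ->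
  (forall n x, `|L x - sqrt_seq A n x| <= (1 - sqrt_maj n) * `|x|) ->
  forall x, 0 <= '[(bop1 H - L) x, x].
Proof.
move=> A1 Asa LP x; rewrite bop_subE hdotBl hdotxx subr_ge0.
have Lr : '[L x, x] \is Num.real.
  by apply/CrealP; rewrite -hdotC (sqrt_limit_selfadjoint LP Asa).
rewrite (le_trans (real_ler_norm Lr))// (le_trans (cauchy_schwarz _ _))//.
by rewrite expr2 ler_wpM2r// (sqrt_limit_contraction LP).
Qed.

(* S commutes with A, hence with the constructed root 1 - L, and the          *)
(* difference D = 1 - L - S satisfies D^3 = 0.                                *)
Lemma sqrt_unique H (A L S : {bop H -> H}) :
  contractive A -> selfadjoint A ->
  (forall n x, `|L x - sqrt_seq A n x| <= (1 - sqrt_maj n) * `|x|) ->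
  (forall x, 0 <= '[S x, x]) -> (forall x, S (S x) = x - A x) ->
  S = bop1 H - L.
Proof.
move=> A1 Asa LP S0 S2.
have Ssa := positive_selfadjoint S0.
have AE x : A x = x - S (S x) by rewrite S2 opprB addrC subrK.
have LS : forall x, L (S x) = S (L x).
  by apply: (sqrt_limit_intertwine LP LP) => x; rewrite !AE bopB.
pose Q := bop1 H - L.
have QE x : Q x = x - L x by rewrite bop_subE.
have Q0 := sqrt_limit_ge0 A1 Asa LP; rewrite -/Q in Q0.
have Qsa := positive_selfadjoint Q0.
have Q2 := sqrt_limit_root A1 LP; rewrite -/Q in Q2.
have QS x : Q (S x) = S (Q x) by rewrite !QE bopB LS.
pose D := Q - S.
have DE x : D x = Q x - S x by rewrite bop_subE.
have QD x : Q (D x) + S (D x) = 0.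
  by rewrite !DE !bopB Q2 S2 QS addrA subrK subrr.
have Dsa : selfadjoint D.
  by move=> x y; rewrite !DE hdotBl hdotBr Qsa Ssa.
have D3 x : D (D (D x)) = 0.
  have -> : D (D (D x)) = (D ** D ** D) x by [].
  rewrite (@qform_eq0 _ (D ** D ** D))// => {}x; rewrite [LHS](Dsa (D (D x)) x).
  (* Two nonnegative numbers with sum 0, because (Q + S) D = Q^2 - S^2 = 0. Both vanish, and with
     them the form of D^3 = D (Q - S) D. *)
  have /eqP : '[Q (D x), D x] + '[S (D x), D x] = 0 by rewrite -hdotDl QD hdot0l.
  rewrite paddr_eq0// => /andP[/eqP q0 /eqP s0].
  by rewrite (DE (D x)) hdotBl q0 s0 subrr.
have D0 x : D x = 0.
  by apply: hdotxx_eq0; rewrite -Dsa [D (D x)]hdotxx_eq0 ?hdot0l// -Dsa D3 hdot0l.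
by apply: bopP => x; apply/esym/eqP; rewrite -subr_eq0 -DE D0.
Qed.

End SquareRoot.

(** * Defect operators of contractions *)

Section Defect.
Context {R : realType}.
Local Notation C := R[i].
Implicit Types H : hilbertType C.
Variables (H1 H2 : hilbertType C) (T : {bop H1 -> H2}).
Hypothesis T1 : contractive T.

Let A := adj T ** T.

Let A1 : contractive A.
Proof. by move=> x; rewrite (le_trans (adj_contraction T1 _))// T1. Qed.

Let Asa : selfadjoint A.
Proof. by move=> x y; rewrite /= adjPl -adjP. Qed.

(** Uniqueness of the positive root identifies the chosen [psqrt] with the constructed 1 - L, from
    which the properties of [defect] below are read off. *)
Lemma defect_limit : exists L : {bop H1 -> H1},
  (forall n x, `|L x - sqrt_seq A n x| <= (1 - sqrt_maj n) * `|x|) /\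
  defect T = bop1 H1 - L.
Proof.
have [L LP] := sqrt_limit_exists A1; exists L; split=> //.
have Lsa := sqrt_limit_selfadjoint LP Asa.
have ex : exists S : {bop H1 -> H1},
    (forall x, 0 <= '[S x, x]) /\ S ** S = bop1 H1 - A.
  exists (bop1 H1 - L); split=> [x|].
    exact: (sqrt_limit_ge0 A1 Asa LP).
  by apply: bopP => x; rewrite [RHS]bop_subE; exact: (sqrt_limit_root A1 LP).
have [S0 S2] := xgetPex 0 ex.
apply: (sqrt_unique A1 Asa LP S0) => x.
rewrite -[RHS](bop_subE (bop1 H1) A).
exact: (congr1 (fun U : {bop H1 -> H1} => U x) S2).
Qed.

Lemma defect_selfadjoint : selfadjoint (defect T).
Proof.
have [L [LP ->]] := defect_limit; move=> x y.
by rewrite !bop_subE hdotBl hdotBr (sqrt_limit_selfadjoint LP Asa).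
Qed.

Lemma defect_sq x : defect T (defect T x) = x - adj T (T x).
Proof. by have [L [LP ->]] := defect_limit; exact: (sqrt_limit_root A1 LP). Qed.

Lemma defect_norm x : `|defect T x| ^+ 2 = `|x| ^+ 2 - `|T x| ^+ 2.
Proof. by rewrite -3!hdotxx defect_selfadjoint defect_sq hdotBr -adjP. Qed.

End Defect.

Lemma defect_intertwine (R : realType) (H1 H2 : hilbertType R[i])
    (T : {bop H1 -> H2}) : contractive T ->
  forall x, defect (adj T) (T x) = T (defect T x).
Proof.
move=> T1 x.
have [L1 [L1P ->]] := defect_limit T1.
have [L2 [L2P ->]] := defect_limit (adj_contraction T1).
rewrite !bop_subE bopB; congr (_ - _).
by apply: (sqrt_limit_intertwine L1P L2P) => y /=; rewrite adjK.
Qed.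

(** * Defect spaces *)

Section Factorization.
Context {R : realType}.
Local Notation C := R[i].
Implicit Types H M N : hilbertType C.

Lemma closure_perp H (A : set H) x :
  (forall y, A y -> '[x, y] = 0) -> forall y, closure A y -> '[x, y] = 0.
Proof.
move=> xA y /closure_eps Ay; apply/eqP; rewrite -normr_le0.
apply: (@le0_of_eps _ _ `|x|) => // e e0; have [z Az yz] := Ay _ e0.
rewrite -[y](subrK z) hdotDr (xA z Az) addr0 (le_trans (cauchy_schwarz _ _))//.
by rewrite mulrC ler_wpM2r// ltW.
Qed.

Section IsometricExtension.
Variables (M H1 H2 : hilbertType C) (D : {bop M -> H1}) (B : {bop M -> H2}).
Hypothesis BD : forall m, `|B m| = `|D m|.

(* The closure of the graph of [D m |-> B m], which is itself a graph.        *)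
Definition closed_graph (z : H1) (w : H2) := forall e : C, 0 < e ->
  exists m, `|z - D m| <= e /\ `|w - B m| <= e.

(** The equality |B m| = |D m| passes to the closure of the graph; applied to a difference, it makes
    the closed relation single-valued. *)
Lemma closed_graph_norm z w : closed_graph z w -> `|w| = `|z|.
Proof.
move=> G; apply: le_anti; apply/andP; split; apply/ler_addgt0Pr => e e0.
  have [m [zm wm]] := G (e / 2) (divr_gt0 e0 (ltr0n _ 2)).
  rewrite -[w](subrK (B m)) (le_trans (ler_normD _ _))// BD addrC.
  rewrite -[D m](subKr z) [in leRHS](splitr e) addrA lerD//.
  by rewrite (le_trans (ler_normB _ _))// lerD2l.
have [m [zm wm]] := G (e / 2) (divr_gt0 e0 (ltr0n _ 2)).
rewrite -[z](subrK (D m)) (le_trans (ler_normD _ _))// -BD addrC.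
rewrite -[B m](subKr w) [in leRHS](splitr e) addrA lerD//.
by rewrite (le_trans (ler_normB _ _))// lerD2l.
Qed.

Lemma closed_graph_lin a z w z' w' : closed_graph z w -> closed_graph z' w' ->
  closed_graph (a *: z + z') (a *: w + w').
Proof.
move=> G G' e e0; have a1 : 0 < `|a| + 1 by rewrite ltr_wpDl.
have e1 : 0 < e / (`|a| + 1) by rewrite divr_gt0.
have [m [zm wm]] := G _ e1; have [m' [zm' wm']] := G' _ e1.
have eE : e = `|a| * (e / (`|a| + 1)) + e / (`|a| + 1).
  by rewrite -[X in _ + X]mul1r -mulrDl mulrC divfK// gt_eqF.
have lin (V : lmodType C) (x y x' y' : V) :
    a *: x + x' - (a *: y + y') = a *: (x - y) + (x' - y').
  by rewrite opprD addrACA scalerBr.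
exists (a *: m + m'); rewrite !bopD !bopZ !lin.
by split; rewrite (le_trans (ler_normD _ _))// eE lerD// normrZ ler_wpM2l.
Qed.

Lemma closed_graph_mem m : closed_graph (D m) (B m).
Proof. by move=> e e0; exists m; rewrite !subrr !normr0 ltW. Qed.

Lemma closed_graph_fun z w w' : closed_graph z w -> closed_graph z w' -> w = w'.
Proof.
move=> G G'; have := closed_graph_lin (-1) G' G.
rewrite !scaleN1r addNr => /closed_graph_norm; rewrite normr0 => /normr0_eq0.
by rewrite addrC => /subr0_eq.
Qed.

Lemma closed_graph_ex z : closure (range D) z -> exists w, closed_graph z w.
Proof.
move=> /closure_eps cz.
have n0 n : 0 < (n.+1%:R^-1 : C) by rewrite invr_gt0.
have exm n : exists m, `|z - D m| <= n.+1%:R^-1.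
  by have [_ [m _ <-] /ltW zm] := cz _ (n0 n); exists m.
have [m mP] := choice exm.
have lim2 (e : C) : 0 < e -> exists n, 2 * (n.+1%:R^-1 : C) <= e.
  move=> e0; have [n ne] := archi_inv_lt (divr_gt0 e0 (ltr0n _ 2)).
  by exists n; rewrite mulrC -ler_pdivlMr// ltW.
have [|//|w _ wP] := @cauchy_rate R H2 (B \o m) (fun n => 2 * n.+1%:R^-1).
  move=> n k nk /=; rewrite -bopB BD bopB.
  have -> : D (m k) - D (m n) = (z - D (m n)) - (z - D (m k)).
    by rewrite opprB [RHS]addrC addrA subrK.
  rewrite (le_trans (ler_normB _ _))// mulr_natl mulr2n lerD//.
  by rewrite (le_trans (mP k))// lef_pV2 ?posrE// ler_nat.
exists w => e /lim2[n ne]; exists (m n); split; last exact: le_trans (wP n) ne.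
rewrite (le_trans (mP n))// (le_trans _ ne)// ler_pMl//; last by rewrite ler1n.
Qed.

Lemma isometric_extension (K : csub H1) : csub_set K = closure (range D) ->
  exists V : {bop K -> H2}, (forall z, `|V z| = `|z|) /\
    (forall z m, incl K z = D m -> V z = B m).
Proof.
move=> KE.
have exw (z : K) : exists w, closed_graph (incl K z) w.
  by apply: closed_graph_ex; rewrite -KE; exact: csub_valP.
have [V VP] := choice exw.
have Vlin : linear V.
  move=> a x y; apply: (closed_graph_fun (VP _)).
  by rewrite bopD bopZ; apply: closed_graph_lin.
have Vn z : `|V z| = `|z| by rewrite (closed_graph_norm (VP z)).
have Vbd : exists k : C, forall x, `|V x| <= k * `|x|.
  by exists 1 => x; rewrite mul1r Vn.
exists (Bop Vlin Vbd); split=> // z m zm.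
by apply: (closed_graph_fun (VP z)); rewrite zm; exact: closed_graph_mem.
Qed.

End IsometricExtension.

Lemma adj_isometryK H1 H2 (V : {bop H1 -> H2}) : (forall z, `|V z| = `|z|) ->
  forall z, adj V (V z) = z.
Proof. by move=> Vn z; apply: hdot_extr => y; rewrite -adjP isometry_dot. Qed.

Lemma adjK_norm H1 H2 (V : {bop H1 -> H2}) : (forall z, adj V (V z) = z) ->
  forall z, `|V z| = `|z|.
Proof.
move=> VK z; apply/eqP; rewrite -(@eqrXn2 _ 2)// -!hdotxx.
by rewrite adjP VK.
Qed.

Section Defect.
Variables (M N : hilbertType C) (G : {bop M -> N}).
Hypothesis G1 : contractive G.
Local Notation K := (defect_space G).

Lemma defect_mem m : csub_set K (defect G m).
Proof. by apply: subset_closure; exists m. Qed.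

Lemma incl_proj_defect m : incl K (proj K (defect G m)) = defect G m.
Proof. by apply: incl_proj; exact: defect_mem. Qed.

(** A vector killed by the selfadjoint D_G is orthogonal to its range, hence to the closure of the
    range, which contains [z] itself. So [defect_pinv] is single-valued. *)
Lemma defect_inj0 (z : K) : defect G (incl K z) = 0 -> z = 0.
Proof.
move=> Dz; apply: hdotxx_eq0; rewrite -incl_dot.
apply: (@closure_perp _ (range (defect G))); last exact: (csub_valP z).
by move=> _ [m _ <-]; rewrite -(defect_selfadjoint G1) Dz hdot0l.
Qed.

Lemma defect_inj (z w : K) :
  defect G (incl K z) = defect G (incl K w) -> z = w.
Proof.
move=> e; apply/eqP; rewrite -subr_eq0; apply/eqP/defect_inj0.
by rewrite !bopB e subrr.
Qed.

(** The hypothesis says |B m| = |D_G m|, so D_G m |-> B m extends to an isometry of the defect space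
    into [H], and [X] is its adjoint. The last equation makes [X] the bounded operator D_G^{-1}
    B^*. *)
Lemma defect_factor H (B : {bop M -> H}) :
  (forall m, `|G m| ^+ 2 + `|B m| ^+ 2 = `|m| ^+ 2) ->
  exists X : {bop H -> K}, [/\ forall z, X (adj X z) = z,
    forall m, B m = adj X (proj K (defect G m)) &
    forall h, adj B h = defect G (incl K (X h))].
Proof.
move=> GB.
have BD m : `|B m| = `|defect G m|.
  apply/eqP; rewrite -(@eqrXn2 _ 2)// (defect_norm G1) -GB.
  by rewrite addrC addKr.
have [V [Vn VB]] := isometric_extension BD (erefl (csub_set K)).
exists (adj V); rewrite !adjK; split.
- exact: adj_isometryK.
- by move=> m; rewrite (VB _ m)// incl_proj_defect.
- move=> h; apply: hdot_extl => m.
  rewrite adjPl (defect_selfadjoint G1) -(incl_proj_defect m) incl_dot adjPl.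
  by rewrite (VB _ m)// incl_proj_defect.
Qed.

End Defect.

End Factorization.

Section Inverse.
Context {R : realType}.
Local Notation C := R[i].
Implicit Types H M N : hilbertType C.

Lemma invP H1 H2 (T : {bop H1 -> H2}) : invertible T -> inverse_of T (inv T).
Proof. exact: xgetPex. Qed.

Lemma bop_invK H1 H2 (T : {bop H1 -> H2}) : invertible T -> forall x, inv T (T x) = x.
Proof.
by move=> /invP[e _] x; exact: (congr1 (fun U : {bop H1 -> H1} => U x) e).
Qed.

Lemma bop_invVK H1 H2 (T : {bop H1 -> H2}) : invertible T -> forall x, T (inv T x) = x.
Proof.
by move=> /invP[_ e] x; exact: (congr1 (fun U : {bop H2 -> H2} => U x) e).
Qed.

Lemma inv_unique H1 H2 (T : {bop H1 -> H2}) (S : {bop H2 -> H1}) :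
  (forall x, S (T x) = x) -> (forall y, T (S y) = y) -> inv T = S.
Proof.
move=> ST TS; have iT : invertible T by exists S; split; apply: bopP.
by apply: bopP => y; rewrite -[in LHS](TS y) bop_invK.
Qed.

Section ResolventTheory.
Variables (H : hilbertType C) (A : {bop H -> H}) (A1 : contractive A).

Definition resolvent (l : C) : {bop H -> H} := inv (bop1 H - l *: A).

Lemma resolventK l x : `|l| < 1 -> resolvent l (x - l *: A x) = x.
Proof.
move=> l1; rewrite -[x - _](bop_subE (bop1 H) (l *: A)) bop_invK//.
exact: resolvent_exists.
Qed.

Lemma resolvent_eq l x : `|l| < 1 ->
  resolvent l x = x + l *: A (resolvent l x).
Proof.
move=> l1; have := bop_invVK (resolvent_exists A1 l1) x; rewrite bop_subE /=.
by move=> /(canRL (subrK _)).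
Qed.

Lemma resolvent_eqr l x : `|l| < 1 ->
  resolvent l x = x + l *: resolvent l (A x).
Proof. by move=> l1; rewrite -[X in X + _](@resolventK l)// bopB bopZ subrK. Qed.

Lemma resolvent_unique l x y : `|l| < 1 -> y = x + l *: A y -> y = resolvent l x.
Proof. by move=> l1 yE; rewrite -[LHS](@resolventK l)// {1}yE addrK. Qed.

Lemma resolvent_norm l x : `|l| < 1 -> `|resolvent l x| <= `|x| / (1 - `|l|).
Proof.
move=> l1; rewrite ler_pdivlMr ?subr_gt0// mulrBr mulr1 lerBlDr.
rewrite {1}resolvent_eq// (le_trans (ler_normD _ _))// lerD2l normrZ mulrC.
by rewrite ler_wpM2r// A1.
Qed.

Lemma resolvent_diff l l' x : `|l| < 1 -> `|l'| < 1 ->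
  resolvent l' x - resolvent l x =
  (l' - l) *: resolvent l' (A (resolvent l x)).
Proof.
move=> l1 l'1; set r := resolvent l x.
have xE : x = r - l *: A r by rewrite {1}/r resolvent_eq// addrK.
rewrite -bopZ -[X in _ - X](@resolventK l')// -bopB; congr (resolvent _ _).
by rewrite {1}xE opprB addrC addrA subrK scalerBl.
Qed.

End ResolventTheory.
End Inverse.

(** * Conservative systems *)

Section Conservative.
Context {R : realType}.
Local Notation C := R[i].
Variables (M N H : hilbertType C) (s : system M N H).
Hypothesis s_cons : conservative s.
Local Notation D := (sysD s).
Local Notation Cs := (sysC s).
Local Notation B := (sysB s).
Local Notation A := (sysA s).

Lemma cons_dot u h u' h' :
  '[D u + Cs h, D u' + Cs h'] + '[B u + A h, B u' + A h'] = '[u, u'] + '[h, h'].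
Proof. by have [/(_ (u, h) (u', h'))] := s_cons. Qed.

Lemma cons_norm u h :
  `|D u + Cs h| ^+ 2 + `|B u + A h| ^+ 2 = `|u| ^+ 2 + `|h| ^+ 2.
Proof. by rewrite -!hdotxx cons_dot. Qed.

Lemma cons_norm_in u : `|D u| ^+ 2 + `|B u| ^+ 2 = `|u| ^+ 2.
Proof.
by have := cons_norm u 0; rewrite !bop_0 !addr0 normr0 expr0n addr0.
Qed.

Lemma cons_norm_state h : `|Cs h| ^+ 2 + `|A h| ^+ 2 = `|h| ^+ 2.
Proof.
by have := cons_norm 0 h; rewrite !bop_0 !add0r normr0 expr0n add0r.
Qed.

Lemma cons_adj_in u h : adj D (D u + Cs h) + adj B (B u + A h) = u.
Proof.
apply: hdot_extl => v; rewrite hdotDl !adjPl.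
by have := cons_dot u h v 0; rewrite !bop_0 !addr0 hdot0r addr0.
Qed.

Lemma cons_adj_state u h : adj Cs (D u + Cs h) + adj A (B u + A h) = h.
Proof.
apply: hdot_extl => v; rewrite hdotDl !adjPl.
by have := cons_dot u h 0 v; rewrite !bop_0 !add0r hdot0r add0r.
Qed.

(** The half of unitarity that uses surjectivity: (y, k) is the image of some (u, h), and the
    adjoint recovers (u, h) from it. *)
Lemma cons_out y k : D (adj D y + adj B k) + Cs (adj Cs y + adj A k) = y.
Proof.
have [_ /(_ (y, k))[[u h] [/= <- <-]]] := s_cons.
by rewrite cons_adj_in cons_adj_state.
Qed.

Lemma cons_state y k : B (adj D y + adj B k) + A (adj Cs y + adj A k) = k.
Proof.
have [_ /(_ (y, k))[[u h] [/= <- <-]]] := s_cons.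
by rewrite cons_adj_in cons_adj_state.
Qed.

Lemma cons_norm_out y : `|adj D y| ^+ 2 + `|adj Cs y| ^+ 2 = `|y| ^+ 2.
Proof.
rewrite -3!hdotxx !adjPl -hdotDr; have := cons_out y 0.
by rewrite !bop_0 !addr0 => ->.
Qed.

Lemma sqr_contraction (a b c : C) : 0 <= a -> 0 <= b -> 0 <= c ->
  a ^+ 2 + b ^+ 2 = c ^+ 2 -> a <= c.
Proof. by move=> a0 b0 c0 e; rewrite -ler_sqr ?nnegrE// -e lerDl exprn_ge0. Qed.

Lemma cons_contrD : contractive D.
Proof. by move=> u; apply: sqr_contraction (cons_norm_in u). Qed.

Lemma cons_contrB : contractive B.
Proof. by move=> u; have := cons_norm_in u; rewrite addrC; apply: sqr_contraction. Qed.

Lemma cons_contrC : contractive Cs.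
Proof. by move=> u; apply: sqr_contraction (cons_norm_state u). Qed.

Lemma cons_contrA : contractive A.
Proof. by move=> u; have := cons_norm_state u; rewrite addrC; apply: sqr_contraction. Qed.

Lemma transferE l u : transfer s l u = D u + l *: Cs (resolvent A l (B u)).
Proof. by []. Qed.

Lemma transfer0 : transfer s 0 = D.
Proof. by apply: bopP => u; rewrite transferE scale0r addr0. Qed.

(** Energy balance: the block operator sends (u, l x) to (Theta(l) u, x), so |Theta(l) u|^2 = |u|^2
    - (1 - |l|^2) |x|^2. *)
Lemma transfer_contraction l : `|l| < 1 -> contractive (transfer s l).
Proof.
move=> l1 u; set x := resolvent A l (B u).
have xE : x = B u + A (l *: x).
  by rewrite bopZ; exact: (resolvent_eq cons_contrA (B u) l1).
have := cons_norm u (l *: x); rewrite -xE bopZ -transferE => e.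
rewrite -ler_sqr ?nnegrE// -(lerD2r (`|x| ^+ 2)) e lerD2l normrZ exprMn.
by rewrite ler_piMl ?exprn_ge0// exprn_ile1// ltW.
Qed.

(** With R the resolvent, the derivative of l R(l) is R(l)^2, and the resolvent identity, used
    twice, leaves the remainder (l' - l)^2 C R(l') A R(l)^2 B. *)
Lemma transfer_analytic : analytic_on_disk (transfer s).
Proof.
have A1 := cons_contrA.
move=> l l1; pose s0 : C := 1 - `|l|.
have s00 : 0 < s0 by rewrite subr_gt0.
exists (Cs ** resolvent A l ** resolvent A l ** B) => e e0.
pose k : C := (s0 ^+ 2)^-1; have k0 : 0 <= k by rewrite invr_ge0 exprn_ge0 ?ltW.
have ek : 0 < e + k + 1 by rewrite ltr_wpDl// addr_ge0// ltW.
pose t := e / (e + k + 1); have t0 : 0 < t by rewrite divr_gt0.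
have t1 : t <= 1 by rewrite ler_pdivrMr// mul1r -addrA lerDl addr_ge0.
have tk : t * k <= e.
  rewrite /t mulrAC ler_pdivrMr// ler_wpM2l ?(ltW e0)//.
  by rewrite [e + k]addrC -addrA lerDl addr_ge0 ?(ltW e0).
(* The factor s0 / 2 keeps 1 - |l'| >= s0 / 2, so the remainder is at most |l' - l|^2 (2 / s0) k
   |x|; the factor [t] brings d (2 / s0) k down to t k <= e. *)
pose d := s0 / 2 * t.
have d0 : 0 < d by rewrite mulr_gt0 ?divr_gt0.
exists d => // l' l'1 l'd x.
have -> : (transfer s l' - transfer s l -
    (l' - l) *: (Cs ** resolvent A l ** resolvent A l ** B)) x =
  (l' - l) ^+ 2 *: Cs (resolvent A l' (A (resolvent A l (resolvent A l (B x))))).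
  rewrite !bop_subE !transferE /= opprD addrACA subrr add0r.
  set y := B x; set r := resolvent A l y; set r' := resolvent A l' y.
  set q := resolvent A l r; set q' := resolvent A l' r.
  have dr : r' - r = (l' - l) *: resolvent A l' (A r) by exact: resolvent_diff.
  have dq : q' - q = (l' - l) *: resolvent A l' (A q) by exact: resolvent_diff.
  have rE : l *: A r = r - y by rewrite {2}/r resolvent_eq// addrC addKr.
  have key : l' *: r' - l *: r = (l' - l) *: q'.
    rewrite -[l' *: r'](subrK (l' *: r)) -scalerBr dr -addrA -scalerBl.
    rewrite scalerA mulrC -scalerA -scalerDr; congr (_ *: _).
    by rewrite /q' [RHS](resolvent_eqr A1)// addrC.
  transitivity (Cs ((l' *: r' - l *: r) - (l' - l) *: q)).
    by rewrite !bopB !bopZ.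
  by rewrite key -scalerBr dq scalerA bopZ expr2.
have s0' : 0 < 1 - `|l'| by rewrite subr_gt0.
have s2 : (1 - `|l'|)^-1 <= 2 / s0.
  rewrite -[2 / s0]invrK invf_div lef_pV2 ?posrE ?divr_gt0//.
  rewrite lerBrDr -lerBrDl; have -> : 1 - s0 / 2 = `|l| + s0 / 2.
    by rewrite {2}(splitr s0) /s0; field.
  rewrite -[l'](subrK l) addrC (le_trans (ler_normD _ _))// lerD2l.
  by rewrite (le_trans (ltW l'd))// ler_piMr// divr_ge0 ?(ltW s00).
have bound : `|Cs (resolvent A l' (A (resolvent A l (resolvent A l (B x)))))| <= 2 / s0 * k * `|x|.
  rewrite (le_trans (cons_contrC _))// (le_trans (resolvent_norm A1 _ l'1))//.
  rewrite mulrC -mulrA ler_pM ?invr_ge0 ?(ltW s0')//.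
  rewrite (le_trans (A1 _))// (le_trans (resolvent_norm A1 _ l1))//.
  rewrite /k expr2 invfM -mulrA mulrC ler_wpM2l ?invr_ge0 ?(ltW s00)//.
  rewrite (le_trans (resolvent_norm A1 _ l1))// mulrC.
  by rewrite ler_wpM2l ?invr_ge0 ?(ltW s00)// cons_contrB.
rewrite normrZ normrX expr2 -mulrA [e * _]mulrC -mulrA ler_wpM2l//.
rewrite (le_trans (ler_pM _ _ (ltW l'd) bound))//.
rewrite !mulrA ler_wpM2r// /d; apply: le_trans tk.
have -> : s0 / 2 * t * 2 / s0 * k = t * k by field; rewrite gt_eqF.
by [].
Qed.

Lemma transfer_schur : schur_class (transfer s).
Proof. by split; [exact: transfer_analytic|exact: transfer_contraction]. Qed.

End Conservative.

(** * Removing the singularity at 0 *)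

Section SchurUnique.
Context {R : realType}.
Local Notation C := R[i].
Implicit Types M N H : hilbertType C.

Lemma exists_lt_three (a b c : C) : 0 < a -> 0 < b -> 0 < c ->
  exists2 l : C, 0 < l & [/\ l < a, l < b & l < c].
Proof.
move=> /complexR_gt0[x x0 ->] /complexR_gt0[y y0 ->] /complexR_gt0[z z0 ->].
pose m : R := Num.min x (Num.min y z) / 2.
have mm : 0 < Num.min x (Num.min y z) by rewrite !lt_min x0 y0 z0.
have : m < Num.min x (Num.min y z) by rewrite ltr_pdivrMr// ltr_pMr// ltr1n.
rewrite !lt_min => /and3P[mx my mz].
by exists (real_complex R m); rewrite ?ltcR ?divr_gt0.
Qed.

(** Both functions are differentiable at 0, so their values there are approximated by their common
    values at small r > 0. This settles [schur_next], which is prescribed only off 0. *)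
Lemma schur_class_punctured M N (F F' : C -> {bop M -> N}) :
  schur_class F -> schur_class F' ->
  (forall l, `|l| < 1 -> l != 0 -> F l = F' l) ->
  forall l, `|l| < 1 -> F l = F' l.
Proof.
move=> [Fan _] [Fan' _] FF' l l1; have [->|] := eqVneq l 0; last exact: FF'.
have z1 : `|0 : C| < 1 by rewrite normr0.
have [T TP] := Fan 0 z1; have [T' TP'] := Fan' 0 z1.
have [d d0 dP] := TP 1 ltr01; have [d' d'0 dP'] := TP' 1 ltr01.
apply: bopP => x; apply/eqP; rewrite -subr_eq0; apply/eqP.
have [k k0 kT] := bop_bound_ge0 (T' - T).
apply: (@eq0_of_eps R _ _ ((2 + k) * `|x|)); first by rewrite mulr_ge0 ?addr_ge0.
move=> e e0.
have [q q0 [qd qd' qe]] := exists_lt_three d0 d'0 e0.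
have [r r0 [rq r1 _]] := exists_lt_three q0 (ltr01 : 0 < 1 :> C) e0.
have rN : `|r| = r by rewrite ger0_norm// ltW.
have := dP r; have := dP' r; rewrite rN subr0 rN => /(_ r1 (lt_trans rq qd') x) h' /(_ r1 (lt_trans rq qd) x) h.
have Fr : F r = F' r by apply: FF'; rewrite ?rN// gt_eqF.
have alg (V : zmodType) (a b b' t t' : V) :
    b - b' = (a - b' - t') - (a - b - t) + (t' - t).
  rewrite (opprD (a - b)) (addrACA (a - b')) -opprD subrK.
  by rewrite opprB [RHS]addrC addrA subrK.
have -> : F 0 x - F' 0 x = (F' r - F' 0 - r *: T') x
    - (F r - F 0 - r *: T) x + r *: (T' - T) x.
  by rewrite !bop_subE Fr scalerBr -alg.
rewrite (le_trans (ler_normD _ _))// (mulrDl 2 k) mulrDr lerD//.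
  rewrite (le_trans (ler_normB _ _))//.
  rewrite mulr_natl mulr2n mulrDr lerD//.
    by rewrite (le_trans h')// mul1r ler_wpM2r// ltW// (lt_trans rq).
  by rewrite (le_trans h)// mul1r ler_wpM2r// ltW// (lt_trans rq).
rewrite normrZ rN; apply: ler_pM => //; first exact: ltW.
by rewrite ltW// (lt_trans rq).
Qed.

End SchurUnique.

(** * Simplicity as triviality of a joint kernel *)

Section Simplicity.
Context {R : realType}.
Local Notation C := R[i].
Implicit Types M N H : hilbertType C.

Lemma powSr H (A : {bop H -> H}) n x : pow A n.+1 x = pow A n (A x).
Proof. by elim: n => // n IHn; exact: (congr1 A IHn). Qed.

Lemma pow_adj H (A : {bop H -> H}) n : adj (pow A n) = pow (adj A) n.
Proof.
elim: n => [|n IHn]; first by apply: adj_unique.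
by apply: adj_unique => x y; rewrite powSr [in RHS]powSr -IHn -2!adjP -powSr.
Qed.

Lemma lspan_submod H (S : set H) : submod_closed (fun x => x \in lspan S).
Proof.
split.
  by rewrite inE; exists 0, (fun=> 0), (fun=> 0); split=> [[]//|]; rewrite big_ord0.
move=> a x y; rewrite !inE => -[n [c [u [Su ->]]]] [m [d [v [Sv ->]]]].
exists (n + m), (fun i => match fintype.split i with inl j => a * c j | inr j => d j end).
exists (fun i => match fintype.split i with inl j => u j | inr j => v j end).
split=> [i|]; first by case: fintype.split.
rewrite big_split_ord scaler_sumr; congr (_ + _); apply: eq_bigr => i _.
  by rewrite (unsplitK (inl i)) scalerA.
by rewrite (unsplitK (inr i)).
Qed.

Lemma sub_lspan H (S : set H) x : S x -> lspan S x.
Proof.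
move=> Sx; exists 1, (fun=> 1), (fun=> x); split=> //.
by rewrite big_ord1 scale1r.
Qed.

Lemma lspan_perp H (S : set H) x :
  (forall y, S y -> '[x, y] = 0) -> forall y, lspan S y -> '[x, y] = 0.
Proof.
move=> xS y [n [c [u [Su ->]]]]; rewrite linear_sumr big1// => i _.
by rewrite /= hdotZr xS ?mulr0.
Qed.

Lemma sum_submod H (A B : set H) :
  submod_closed (fun x => x \in A) -> submod_closed (fun x => x \in B) ->
  submod_closed (fun x => x \in [set x + y | x in A & y in B]).
Proof.
move=> [A0 Al] [B0 Bl]; split.
  by rewrite inE; exists 0; [exact/set_mem|exists 0; [exact/set_mem|rewrite addr0]].
move=> a x y; rewrite !inE => -[u Au [v Bv <-]] [u' Au' [v' Bv' <-]].
exists (a *: u + u'); first by apply/set_mem/Al; exact/mem_set.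
exists (a *: v + v'); first by apply/set_mem/Bl; exact/mem_set.
by rewrite scalerDr addrACA.
Qed.

(** By duality, x is orthogonal to every A^n B m exactly when all B^* A^{*n} x vanish, and similarly
    for the observable space; simplicity means that only 0 is orthogonal to both. *)
Lemma simpleP M N H (s : system M N H) : simple_system s <->
  forall x, (forall n, adj (sysB s) (pow (adj (sysA s)) n x) = 0) ->
            (forall n, sysC s (pow (sysA s) n x) = 0) -> x = 0.
Proof.
set Sc := [set x | exists n m, x = pow (sysA s) n (sysB s m)].
set So := [set x | exists n y, x = pow (adj (sysA s)) n (adj (sysC s) y)].
have cE x n m : '[x, pow (sysA s) n (sysB s m)] =
    '[adj (sysB s) (pow (adj (sysA s)) n x), m].
  by rewrite adjPl -pow_adj adjPl.
have oE x n y : '[x, pow (adj (sysA s)) n (adj (sysC s) y)] =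
    '[sysC s (pow (sysA s) n x), y].
  by rewrite adjP -pow_adj adjP.
split=> [sT x xc xo|s0].
  apply: hdotxx_eq0; apply: (@closure_perp _ _ _ _ _ x); last first.
    by have : [set: H] x by []; rewrite -sT; apply.
  move=> _ [u cu [v cv <-]]; rewrite hdotDr.
  rewrite (closure_perp (lspan_perp _) cu) ?(closure_perp (lspan_perp _) cv) ?addr0//.
    by move=> _ [n [y ->]]; rewrite oE xo hdot0l.
  by move=> _ [n [m ->]]; rewrite cE xc hdot0l.
pose V := CSub (closure_submod (sum_submod
  (closure_submod (lspan_submod Sc)) (closure_submod (lspan_submod So))))
  (@closed_closure _ _).
rewrite /simple_system -[LHS]/(csub_set V); apply: csub_full => x xV.
have c0 : closure (lspan Sc) 0 by have [/set_mem] := closure_submod (lspan_submod Sc).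
have o0 : closure (lspan So) 0 by have [/set_mem] := closure_submod (lspan_submod So).
apply: s0 => n; apply: hdot_extl => y; rewrite hdot0l -?cE -?oE.
  apply: xV; apply: subset_closure; exists (pow (sysA s) n (sysB s y)).
    by apply/subset_closure/sub_lspan; exists n, y.
  by exists 0 => //; rewrite addr0.
apply: xV; apply: subset_closure; exists 0 => //.
exists (pow (adj (sysA s)) n (adj (sysC s) y)); last by rewrite add0r.
by apply/subset_closure/sub_lspan; exists n, y.
Qed.

End Simplicity.

(** * Uniqueness of the Möbius parameter *)

Section DefectSpaceMap.
Context {R : realType}.
Local Notation C := R[i].
Implicit Types M N H : hilbertType C.

Lemma eps_closure H (A : set H) x :
  (forall e : C, 0 < e -> exists2 y, A y & `|x - y| < e) -> closure A x.
Proof.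
move=> xA B /nbhs_ballP[e /= e0 eB]; have [y Ay xy] := xA e e0.
by exists y; split=> //; apply: eB; rewrite -ball_normE.
Qed.

Lemma adj_defect_mem M N (G : {bop M -> N}) (z : defect_space (adj G)) :
  contractive G -> csub_set (defect_space G) (adj G (incl _ z)).
Proof.
move=> G1; apply: eps_closure => e e0.
have [_ [n _ <-] zn] := closure_eps (csub_valP z) e0.
exists (defect G (adj G n)); first by exists (adj G n).
have := defect_intertwine (adj_contraction G1) n; rewrite adjK => ->.
by rewrite -bopB (le_lt_trans (adj_contraction G1 _)).
Qed.

Lemma defect_dense M N H (G : {bop M -> N}) (S T : {bop defect_space G -> H}) :
  contractive G ->
  (forall m, S (proj _ (defect G m)) = T (proj _ (defect G m))) -> S = T.
Proof.
move=> G1 ST; apply: bop_dotP => u v; apply/eqP; rewrite -subr_eq0 -hdotBl.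
rewrite -bop_subE adjP; set a := adj _ v.
suff -> : a = 0 by rewrite hdot0r.
apply: (defect_inj0 G1); apply: hdot_extl => m.
rewrite hdot0l (defect_selfadjoint G1) -incl_proj_defect incl_dot /a adjPl.
by rewrite bop_subE ST subrr hdot0r.
Qed.

(** Since D_{G^*} is injective on its defect space and D_G has dense range in its own, Theta(l)
    determines Q = Z W^{-1}. Then W^{-1} = 1 - G^* Q is determined, and so is Z = Q W. *)
Lemma moebius_unique M N (Th : C -> {bop M -> N}) Z Z' : contractive (Th 0) ->
  is_moebius_parameter (Th := Th) Z -> is_moebius_parameter (Th := Th) Z' ->
  forall l, `|l| < 1 -> Z l = Z' l.
Proof.
move=> G1 [_ _ ZP] [_ _ ZP'] l l1.
have [] := ZP l l1; have [] := ZP' l l1.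
set Gt := proj _ ** _ ** _; set W := bop1 _ + Gt ** Z l.
set W' := bop1 _ + Gt ** Z' l => iW' -> iW ThE.
have Q : Z' l ** inv W' = Z l ** inv W.
  apply: (defect_dense G1) => m; apply: (defect_inj (adj_contraction G1)).
  have := congr1 (fun T : {bop M -> N} => T m) ThE.
  by rewrite !bop_addE => /addrI.
have QE u : Z' l (inv W' u) = Z l (inv W u).
  exact: (congr1 (fun T : {bop _ -> _} => T u) Q).
have iWE u : inv W u = u - Gt (Z l (inv W u)).
  by have /(canRL (addrK _)) := bop_invVK iW u.
have iWE' u : inv W' u = u - Gt (Z' l (inv W' u)).
  by have /(canRL (addrK _)) := bop_invVK iW' u.
have iWW u : inv W' u = inv W u by rewrite iWE' iWE QE.
have WW u : W u = W' u by rewrite -[in LHS](bop_invK iW' u) iWW bop_invVK.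
by apply: bopP => u; rewrite -[in LHS](bop_invK iW u) -QE WW bop_invK.
Qed.

End DefectSpaceMap.

(** * One step of the Schur algorithm *)

Section Step.
Context {R : realType}.
Local Notation C := R[i].
Variables (M N H H' : hilbertType C) (s : system M N H) (Th : C -> {bop M -> N}).
Variables (J : {bop H' -> H}).
Local Notation G := (Th 0).
Local Notation K := (defect_space G).
Local Notation L := (defect_space (adj G)).
Local Notation Cs := (sysC s).
Local Notation B := (sysB s).
Local Notation A := (sysA s).
(** [X] and [Y] are the co-isometries of [defect_factor], and [J] is an isometry onto ker C. Keeping
    [J] abstract lets [H'] be H_{n+1,0} when [H] is H_{n,0}. *)
Variables (X : {bop H -> K}) (Y : {bop H -> L}).
Hypothesis s_cons : conservative s.
Hypothesis DG : sysD s = G.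
Hypothesis JJ : forall h, adj J (J h) = h.
Hypothesis J_range : forall x, Cs x = 0 <-> exists h, x = J h.
Hypothesis XX : forall z, X (adj X z) = z.
Hypothesis BX : forall m, B m = adj X (proj K (defect G m)).
Hypothesis adjBX : forall h, adj B h = defect G (incl K (X h)).
Hypothesis YY : forall z, Y (adj Y z) = z.
Hypothesis CY : forall h, Cs h = defect (adj G) (incl L (Y h)).

Local Notation Gt := (proj K ** adj G ** incl L).

Let G1 : contractive G.
Proof. by rewrite -DG; exact: cons_contrD. Qed.

Lemma step_incl_Gt z : incl K (Gt z) = adj G (incl L z).
Proof. exact: (incl_proj (adj_defect_mem (z := z) G1)). Qed.

Lemma step_Y_eq0 h : Cs h = 0 -> Y h = 0.
Proof. by rewrite CY => /(defect_inj0 (adj_contraction G1)). Qed.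

(** Unitarity gives G^* C + B^* A = 0. With the factorizations and G^* D_{G^*} = D_G G^* this
    becomes D_G (G^* Y + X A) = 0, and D_G is injective on its defect space. *)
Lemma step_XA h : X (A h) = - Gt (Y h).
Proof.
apply: (defect_inj G1); rewrite -adjBX (bopN (incl K)) bopN step_incl_Gt.
have := defect_intertwine (adj_contraction G1) (incl L (Y h)).
rewrite adjK -CY => ->; apply/eqP; rewrite -addr_eq0 addrC -DG.
by have := cons_adj_in s_cons 0 h; rewrite !bop_0 !add0r => ->.
Qed.

(** On ker X the operator B^* vanishes, so G B^* + C A^* = 0 leaves C A^* = 0; in the same way B B^*
    + A A^* = 1 leaves A A^* = 1 below. *)
Lemma step_CadjA z : X z = 0 -> Cs (adj A z) = 0.
Proof.
move=> Xz; have := cons_out s_cons 0 z.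
by rewrite adjBX Xz !bop_0 !add0r bop_0 add0r.
Qed.

Lemma step_AadjA z : X z = 0 -> A (adj A z) = z.
Proof.
move=> Xz; have := cons_state s_cons 0 z.
by rewrite adjBX Xz !bop_0 !add0r bop_0 add0r.
Qed.

(** The difference [w] of the two sides satisfies X w = 0 by [step_XA], hence C A^* w = 0 and Y A^*
    w = 0; pairing [w] with its definition gives <w, w> = 0. *)
Lemma step_AadjY z : A (adj Y z) = - adj X (Gt z).
Proof.
apply/eqP; rewrite -addr_eq0; apply/eqP; set w := _ + _.
have Xw : X w = 0 by rewrite /w bopD step_XA YY XX addNr.
apply: hdotxx_eq0; rewrite {1}/w hdotDl adjPl Xw hdot0r addr0 adjP adjPl.
by rewrite step_Y_eq0 ?hdot0r// step_CadjA.
Qed.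

Lemma step_YJ h : Y (J h) = 0.
Proof. by apply/step_Y_eq0/J_range; exists h. Qed.

Lemma step_adjJY z : adj J (adj Y z) = 0.
Proof. by apply: hdot_extl => h; rewrite adjPl adjPl step_YJ hdot0r hdot0l. Qed.

(** Y^* Y and J J^* are complementary projections: x - Y^* Y x is killed by Y, hence by C, so it
    lies in the range of J. *)
Lemma step_decomp x : x = adj Y (Y x) + J (adj J x).
Proof.
have [k xk] : exists k, x - adj Y (Y x) = J k.
  by apply/J_range; rewrite CY bopB YY subrr !bop_0.
have : adj J (x - adj Y (Y x)) = k by rewrite xk JJ.
by rewrite bopB step_adjJY subr0 => ->; rewrite -xk addrC subrK.
Qed.

Lemma step_decomp_dot x y : '[Y x, Y y] + '[adj J x, adj J y] = '[x, y].
Proof. by rewrite adjP adjPl -hdotDr -step_decomp. Qed.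

Lemma step_ker x : Y x = 0 -> J (adj J x) = x.
Proof. by move=> Yx; rewrite [RHS]step_decomp Yx bop_0 add0r. Qed.

Lemma step_XAJ h : X (A (J h)) = 0.
Proof. by rewrite step_XA step_YJ bop_0 oppr0. Qed.

Lemma step_AJ_dot h h' : '[A (J h), A (J h')] = '[h, h'].
Proof.
have := cons_adj_state s_cons 0 (J h'); rewrite !bop_0 !add0r.
have -> : Cs (J h') = 0 by apply/J_range; exists h'.
by rewrite bop_0 add0r adjP => ->; rewrite adjP JJ.
Qed.

Lemma step_XAJ_dot u h u' h' :
  '[adj X u + A (J h), adj X u' + A (J h')] = '[u, u'] + '[h, h'].
Proof.
rewrite hdotDl !hdotDr step_AJ_dot !adjPl XX step_XAJ hdot0r addr0.
by rewrite (hdotC (A _)) adjPl step_XAJ hdot0r conjC0 add0r.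
Qed.

(** On ker X one has A A^* = 1 and A^* maps into ker C, the range of J. So A J reaches all of ker X,
    and X^* reaches its complement. *)
Lemma step_XAJ_surj w : adj X (X w) + A (J (adj J (adj A (w - adj X (X w))))) = w.
Proof.
set v := w - _; have Xv : X v = 0 by rewrite bopB XX subrr.
rewrite step_ker ?step_AadjA//; first by rewrite addrC subrK.
by apply/step_Y_eq0/step_CadjA.
Qed.

(* Since [Y J = 0] and [X A J = 0], the maps [(u, h) |-> X^* u + A J h] and   *)
(* [x |-> (Y x, J^* x)] are unitary, and [step_sys] is their composition.     *)
Definition step_sys : system K L H' :=
  System (Y ** adj X) (Y ** A ** J) (adj J ** adj X) (adj J ** A ** J).

(* Its transfer function is [l Theta_1(l)], the Moebius parameter.            *)
Definition moebius_sys : system K L H := System 0 Y (adj X) (A ** J ** adj J).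

Lemma step_sys_conservative : conservative step_sys.
Proof.
split=> [[u h] [u' h']|[y k]].
  by rewrite /dsum_dot /= -!bopD step_decomp_dot step_XAJ_dot.
set w := adj Y y + J k.
have Yw : Y w = y by rewrite bopD YY step_YJ addr0.
have Jw : adj J w = k by rewrite bopD step_adjJY JJ add0r.
exists (X w, adj J (adj A (w - adj X (X w)))).
by rewrite /block_op /= -(bopD Y) -(bopD (adj J)) step_XAJ_surj Yw Jw.
Qed.

Lemma moebius_sys_conservative : conservative moebius_sys.
Proof.
split=> [[u h] [u' h']|[y k]].
  rewrite /dsum_dot /= !add0r step_XAJ_dot addrCA; congr (_ + _).
  exact: step_decomp_dot.
set g := adj J (adj A (k - adj X (X k))).
exists (X k, adj Y y + J g).
rewrite /block_op /= add0r (bopD Y) YY step_YJ addr0 (bopD (adj J)) step_adjJY.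
by rewrite add0r JJ step_XAJ_surj.
Qed.

Local Notation A0 := (A ** J ** adj J).
Local Notation Z := (transfer moebius_sys).

Let A1 : contractive A := cons_contrA s_cons.
Let A01 : contractive A0 := cons_contrA moebius_sys_conservative.

(** The feedback formula: A agrees with A0 on ker C and with -X^* G^* Y on the range of Y^*, where
    A0 vanishes. *)
Lemma step_A x : A x = A0 x - adj X (Gt (Y x)).
Proof. by rewrite {1}[x]step_decomp bopD step_AadjY addrC. Qed.

Lemma moebius_transferE l u : Z l u = l *: Y (resolvent A0 l (adj X u)).
Proof. by rewrite transferE add0r. Qed.

Section Disk.
Variables (l : C) (l1 : `|l| < 1).

(* [A] is [A0] with the feedback [- X^* Gt Y], see [step_A].                  *)
Lemma resolvent_feedback u :
  resolvent A0 l (adj X u) = resolvent A l (adj X (u + Gt (Z l u))).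
Proof.
set x := resolvent A0 l _; apply: (resolvent_unique A1 l1).
have xE : x = adj X u + l *: A0 x by exact: (resolvent_eq A01 _ l1).
rewrite moebius_transferE -/x (bopZ Gt) bopD bopZ step_A scalerBr.
by rewrite addrACA subrr addr0 -xE.
Qed.

Lemma resolvent_feedback_inv u :
  resolvent A l (adj X u) =
  resolvent A0 l (adj X (u - l *: Gt (Y (resolvent A l (adj X u))))).
Proof.
set x := resolvent A l _; apply: (resolvent_unique A01 l1).
have xE : x = adj X u + l *: A x by exact: (resolvent_eq A1 _ l1).
by rewrite {1}xE bopB bopZ step_A scalerBr addrAC addrA.
Qed.

(** The explicit inverse of W(l) = 1 + G^* Z(l), found by solving the feedback equation with the
    resolvent of [A] in place of that of [A0]. *)
Definition moebius_inv : {bop K -> K} :=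
  bop1 K - l *: (Gt ** Y ** resolvent A l ** adj X).

Lemma moebius_invE u : moebius_inv u = u - l *: Gt (Y (resolvent A l (adj X u))).
Proof. by rewrite bop_subE. Qed.

Local Notation W := (bop1 K + Gt ** Z l).

Lemma moebius_WE u : W u = u + Gt (Z l u).
Proof. by []. Qed.

Lemma moebius_invK u : moebius_inv (W u) = u.
Proof.
rewrite moebius_invE moebius_WE -resolvent_feedback.
by rewrite moebius_transferE (bopZ Gt) addrK.
Qed.

Lemma moebius_invVK u : W (moebius_inv u) = u.
Proof.
rewrite moebius_WE moebius_transferE moebius_invE -resolvent_feedback_inv.
by rewrite (bopZ Gt) subrK.
Qed.

End Disk.

Hypothesis s_transfer : has_transfer s Th.

(** With R the resolvent of A, Theta(l) - G = l C R B = D_{G^*} l Y R X^* D_G, and the feedback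
    turns l Y R X^* into Z W^{-1}. *)
Lemma moebius_sys_parameter : is_moebius_parameter (Th := Th) (transfer moebius_sys).
Proof.
split; [exact: transfer_schur moebius_sys_conservative|exact: transfer0|].
move=> l l1; have iW : inv (bop1 K + Gt ** transfer moebius_sys l) = moebius_inv l.
  by apply: inv_unique => u; rewrite ?moebius_invK ?moebius_invVK.
split.
  exists (moebius_inv l); split; apply: bopP => u; [exact: moebius_invK|].
  exact: moebius_invVK.
rewrite iW; apply: bopP => m; rewrite {1}s_transfer// transferE DG bop_addE.
congr (_ + _); rewrite CY BX -[RHS]/(defect (adj G) (incl L (Z l (moebius_inv l _)))).
rewrite moebius_transferE moebius_invE -resolvent_feedback_inv//.
by rewrite (bopZ (incl L)) bopZ.
Qed.

Lemma moebius_parameterE l : `|l| < 1 ->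
  moebius_parameter Th l = transfer moebius_sys l.
Proof.
apply: (moebius_unique G1); last exact: moebius_sys_parameter.
exact: (xgetPex _ (ex_intro _ _ moebius_sys_parameter)).
Qed.

(** The state x = X^* u + l A J J^* x of [moebius_sys] projects to the state J^* x of [step_sys];
    applying Y to this equation gives the transfer function. *)
Lemma step_sys_transferE l u : `|l| < 1 ->
  transfer step_sys l u = Y (resolvent A0 l (adj X u)).
Proof.
move=> l1; set x := resolvent A0 l _.
have xE : x = adj X u + l *: A (J (adj J x)) by exact: (resolvent_eq A01 _ l1).
have gE : adj J x = resolvent (adj J ** A ** J) l (adj J (adj X u)).
  apply: (resolvent_unique (cons_contrA step_sys_conservative) l1).
  by rewrite {1}xE bopD bopZ.
by rewrite transferE [RHS](congr1 Y xE) bopD bopZ gE.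
Qed.

Lemma step_sys_transfer : has_transfer step_sys (schur_next Th).
Proof.
have Zl l u : `|l| < 1 -> Z l u = l *: transfer step_sys l u.
  by move=> l1; rewrite step_sys_transferE// moebius_transferE.
have next : schur_class (transfer step_sys) /\
    forall l, `|l| < 1 -> l != 0 ->
    transfer step_sys l = l^-1 *: moebius_parameter Th l.
  split=> [|l l1 l0]; first exact: transfer_schur step_sys_conservative.
  apply: bopP => u; rewrite moebius_parameterE// -[RHS]/(l^-1 *: Z l u) Zl// scalerA mulVf//.
  by rewrite scale1r.
have exnext : exists F : C -> {bop K -> L}, schur_class F /\
    forall l, `|l| < 1 -> l != 0 -> F l = l^-1 *: moebius_parameter Th l.
  by exists (transfer step_sys).
have [nextS nextE] := xgetPex (fun=> 0) exnext.
apply: (schur_class_punctured nextS next.1) => l l1 l0.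
by rewrite nextE// next.2.
Qed.

Hypothesis s_simple : simple_system s.

(** If all outputs Y A J of the orbit of x vanish, the orbit of J x under A stays in ker C and is
    the image under J of the orbit of x; the conditions on X give the same for the adjoint. So J x
    lies in the joint kernel for [s]. *)
Lemma step_sys_simple : simple_system step_sys.
Proof.
apply/simpleP => x xc xo.
have A1E : adj (sysA step_sys) = adj J ** adj A ** J.
  by rewrite !adj_comp adjK; exact: bopP.
have B1E : adj (sysB step_sys) = X ** J by rewrite adj_comp !adjK.
rewrite B1E A1E in xc.
have Jo n : J (pow (sysA step_sys) n x) = pow A n (J x).
  elim: n => // n IHn; rewrite [RHS]/= -/(pow A n) -IHn.
  by apply: step_ker; exact: xo.
have Jc n : J (pow (adj J ** adj A ** J) n x) = pow (adj A) n (J x).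
  elim: n => // n IHn; rewrite [RHS]/= -/(pow _ n) -IHn.
  by apply/step_ker/step_Y_eq0/step_CadjA; exact: xc.
rewrite -[x]JJ; have -> : J x = 0; last by rewrite bop_0.
apply: (simpleP s).1 => // n; first by rewrite adjBX -Jc [X _]xc !bop_0.
by rewrite -Jo; apply/J_range; exists (pow (sysA step_sys) n x).
Qed.

End Step.

(** The equations for [X] and [Y] are kept in the conclusion because they say that X h and Y h are
    the pseudo-inverses applied to B^* h and C h. *)
Lemma schur_step_system (R : realType) (M N H H' : hilbertType R[i])
    (Th : R[i] -> {bop M -> N}) (s : system M N H) (J : {bop H' -> H}) :
  conservative s -> simple_system s -> has_transfer s Th ->
  (forall h, adj J (J h) = h) ->
  (forall x, sysC s x = 0 <-> exists h, x = J h) ->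
  exists (X : {bop H -> defect_space (Th 0)})
         (Y : {bop H -> defect_space (adj (Th 0))}),
    let s1 := step_sys s J X Y in
    [/\ forall h, adj (sysB s) h = defect (Th 0) (incl _ (X h)),
        forall h, sysC s h = defect (adj (Th 0)) (incl _ (Y h)),
        conservative s1, simple_system s1 & has_transfer s1 (schur_next Th)].
Proof.
move=> s_cons s_simple s_tr JJ JR.
have DG : sysD s = Th 0 by rewrite s_tr ?normr0// transfer0.
have G1 : contractive (Th 0) by rewrite -DG; exact: cons_contrD.
have [|X [XX BX adjBX]] := defect_factor G1 (B := sysB s).
  by move=> m; rewrite -DG cons_norm_in.
have [|Y [YY _ CY]] := defect_factor (adj_contraction G1) (B := adj (sysC s)).
  by move=> m; rewrite -DG cons_norm_out.
rewrite adjK in CY; exists X, Y; split=> //.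
- exact: step_sys_conservative.
- exact: step_sys_simple.
- exact: step_sys_transfer.
Qed.

(** * Iteration and the spaces H_{n,m} *)

Section ContractionPowers.
Context {R : realType}.
Local Notation C := R[i].
Implicit Types H M N : hilbertType C.

Lemma ker_defectP H1 H2 (T : {bop H1 -> H2}) x : contractive T ->
  csub_set (ker (defect T)) x <-> `|T x| = `|x|.
Proof.
move=> T1; split=> [/= Dx|Tx] /=.
  have := defect_norm T1 x; rewrite Dx normr0 expr0n => /esym/subr0_eq/eqP.
  by rewrite eqrXn2// => /eqP.
have := defect_norm T1 x; rewrite Tx subrr => /eqP.
by rewrite sqrf_eq0 normr_eq0 => /eqP.
Qed.

Lemma adjK_of_norm H1 H2 (T : {bop H1 -> H2}) x : contractive T ->
  `|T x| = `|x| -> adj T (T x) = x.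
Proof.
move=> T1 /(ker_defectP _ T1) /= Dx; apply/esym/eqP.
by rewrite -subr_eq0 -(defect_sq T1) Dx bop_0.
Qed.

Lemma pow_contractive H (A : {bop H -> H}) n : contractive A -> contractive (pow A n).
Proof.
by move=> A1; elim: n => // n IHn x; rewrite (le_trans (A1 _)).
Qed.

Lemma powD H (A : {bop H -> H}) p k x : pow A (p + k) x = pow A p (pow A k x).
Proof. by elim: p => // p IHp; exact: (congr1 A IHp). Qed.

(** The kernel of D_T is where T keeps the norm. At exponent 0 that condition is trivial, which
    merges the four cases of [Hnm]. *)
Lemma Hnm_mem H (A : {bop H -> H}) n m x : contractive A ->
  csub_set (Hnm A n m) x <->
  `|pow A n x| = `|x| /\ `|pow (adj A) m x| = `|x|.
Proof.
move=> A1; have A1' := adj_contraction A1.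
have kA := ker_defectP _ (pow_contractive _ A1).
have kA' := ker_defectP _ (pow_contractive _ A1').
case: n m => [|n] [|m] //.
- split=> [/kA' //|[_ ?]]; exact/kA'.
- split=> [/kA //|[? _]]; exact/kA.
- by split=> [[/kA ? /kA' ?] //|[? ?]]; split; [exact/kA|exact/kA'].
Qed.

Lemma norm_pow_factor H (A : {bop H -> H}) p k x : contractive A ->
  `|pow A (p + k) x| = `|x| -> `|pow A k x| = `|x|.
Proof.
move=> A1 Ax; apply: le_anti; rewrite (pow_contractive _ A1)/= -Ax powD.
exact: pow_contractive.
Qed.

Lemma proj_contractive H (K : csub H) : contractive (proj K).
Proof.
move=> x; rewrite -(adjK (proj K)); apply: adj_contraction => y.
by rewrite adj_proj incl_norm.
Qed.

End ContractionPowers.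

(** * Unitary change of state space *)

Section Transport.
Context {R : realType}.
Local Notation C := R[i].
Variables (M N H1 H2 : hilbertType C) (s : system M N H1) (U : {bop H1 -> H2}).
Hypothesis UK : forall x, adj U (U x) = x.
Hypothesis UVK : forall y, U (adj U y) = y.

Definition transport : system M N H2 :=
  System (sysD s) (sysC s ** adj U) (U ** sysB s) (U ** sysA s ** adj U).

Lemma transport_conservative : conservative s -> conservative transport.
Proof.
move=> s_cons; split=> [[u h] [u' h']|[y k]].
  rewrite /dsum_dot /= -!(bopD U) (isometry_dot (adjK_norm UK)).
  by rewrite (cons_dot s_cons) adjPl UVK.
have [_ /(_ (y, adj U k))[[u h] [/= yE kE]]] := s_cons.
by exists (u, U h); rewrite /block_op /= UK yE -(bopD U) kE UVK.
Qed.

Lemma transport_simple : simple_system s -> simple_system transport.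
Proof.
move=> /simpleP s0; apply/simpleP => x xc xo; rewrite -[x]UVK.
have AE n : adj U (pow (sysA transport) n x) = pow (sysA s) n (adj U x).
  elim: n => // n IHn.
  by rewrite -[LHS]/(adj U (U (sysA s (adj U (pow (sysA transport) n x))))) UK IHn.
have adjAE z : adj (sysA transport) z = U (adj (sysA s) (adj U z)).
  by rewrite 2!adj_comp adjK.
have A'E n : adj U (pow (adj (sysA transport)) n x) = pow (adj (sysA s)) n (adj U x).
  elim: n => // n IHn; set z := pow (adj (sysA transport)) n x in IHn.
  by rewrite -[LHS]/(adj U (adj (sysA transport) z)) adjAE UK IHn.
rewrite (s0 (adj U x)) ?bop_0// => n; last by rewrite -AE; exact: xo.
by rewrite -A'E; have := xc n; rewrite adj_comp.
Qed.

Lemma transport_transfer Th : conservative s ->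
  has_transfer s Th -> has_transfer transport Th.
Proof.
move=> s_cons sTh l l1; rewrite sTh//; apply: bopP => u; rewrite !transferE.
congr (_ + _ *: _) => /=; congr (sysC s _).
set x := resolvent _ l (sysB s u).
have xE : x = sysB s u + l *: sysA s x by exact: (resolvent_eq (cons_contrA s_cons) _ l1).
have -> : resolvent (U ** sysA s ** adj U) l (U (sysB s u)) = U x.
  apply/esym/(resolvent_unique _ l1); last by rewrite /= UK -bopZ -bopD -xE.
  exact: (cons_contrA (transport_conservative s_cons)).
by rewrite UK.
Qed.

End Transport.

Lemma transport_similar (R : realType) (M N H1 H2 H3 : hilbertType R[i])
    (s : system M N H1) (U : {bop H1 -> H2}) (V : {bop H1 -> H3}) :
  (forall x, adj U (U x) = x) -> (forall y, U (adj U y) = y) ->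
  (forall x, adj V (V x) = x) -> (forall y, V (adj V y) = y) ->
  unitarily_similar (transport s U) (transport s V).
Proof.
move=> UK UVK VK VVK; split=> //; exists (V ** adj U); split.
  split=> [x x'|y]; last by exists (U (adj V y)); rewrite /= UK VVK.
  by rewrite /= (isometry_dot (adjK_norm VK)) adjPl UVK.
have -> : inv (V ** adj U) = U ** adj V.
  by apply: inv_unique => x /=; rewrite ?VK ?UVK ?UK ?VVK.
by split; apply: bopP => x /=; rewrite !VK.
Qed.

Lemma Anm_dot (R : realType) (H : hilbertType R[i]) (A : {bop H -> H}) n m
    (x y : Hnm A n m) : '[Anm A n m x, y] = '[A (incl _ x), incl _ y].
Proof. exact: proj_dot. Qed.

(** * The unitary A^k from H_{n,0} onto H_{n-k,k} *)

Section Shift.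
Context {R : realType}.
Local Notation C := R[i].
Variables (H : hilbertType C) (A : {bop H -> H}) (A1 : contractive A).
Variables (n p k : nat) (npk : n = (p + k)%N).

(** The exponent [n] is a separate variable tied to [p + k] by an equation, as (n - k) + k does not
    reduce to n. *)
Definition state_shift : {bop Hnm A n 0 -> Hnm A p k} :=
  proj (Hnm A p k) ** pow A k ** incl (Hnm A n 0).

Lemma shift_pow_adj (x : Hnm A n 0) :
  adj (pow A k) (pow A k (incl _ x)) = incl _ x.
Proof.
have /(Hnm_mem n 0 _ A1)[xn _] := csub_valP x.
apply: adjK_of_norm; first exact: pow_contractive.
by apply: (@norm_pow_factor _ _ _ p) => //; rewrite -npk.
Qed.

(** No norm is lost under A^{p+k}, so A^p keeps the norm of A^k x, and A^{*k} keeps it because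
    A^{*k} A^k x = x. *)
Lemma incl_shift (x : Hnm A n 0) : incl _ (state_shift x) = pow A k (incl _ x).
Proof.
apply: incl_proj; apply/(Hnm_mem p k _ A1).
have /(Hnm_mem n 0 _ A1)[xn _] := csub_valP x.
have xk : `|pow A k (incl _ x)| = `|incl _ x|.
  by apply: (@norm_pow_factor _ _ _ p) => //; rewrite -npk.
by rewrite -powD -npk xn xk -pow_adj shift_pow_adj.
Qed.

Lemma shiftK (x : Hnm A n 0) : adj state_shift (state_shift x) = x.
Proof.
apply: adj_isometryK => z; rewrite -incl_norm incl_shift -[RHS]incl_norm.
have /(Hnm_mem n 0 _ A1)[zn _] := csub_valP z.
by apply: (@norm_pow_factor _ _ _ p) => //; rewrite -npk.
Qed.

Lemma shift_surj (y : Hnm A p k) : exists x, state_shift x = y.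
Proof.
have /(Hnm_mem p k _ A1)[yp yk] := csub_valP y.
have A1' := adj_contraction A1.
have yE : pow A k (pow (adj A) k (incl _ y)) = incl _ y.
  rewrite -[A in pow A k]adjK -pow_adj; apply: adjK_of_norm => //.
  exact: pow_contractive.
have xH : csub_set (Hnm A n 0) (pow (adj A) k (incl _ y)).
  by apply/(Hnm_mem n 0 _ A1); split=> //; rewrite npk powD yE yp yk.
by exists (csub_in xH); apply: incl_inj; rewrite incl_shift.
Qed.

Lemma shiftVK (y : Hnm A p k) : state_shift (adj state_shift y) = y.
Proof. by have [x <-] := shift_surj y; rewrite shiftK. Qed.

(** Compressions disappear in the forms: <A A^k x, A^k x'> = <A x, A^{*k} A^k x'> = <A x, x'>. *)
Lemma shift_Anm : state_shift ** Anm A n 0 ** adj state_shift = Anm A p k.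
Proof.
apply: bop_dotP => y y'; have [x <-] := shift_surj y; have [x' <-] := shift_surj y'.
rewrite -[LHS]/('[state_shift (Anm A n 0 (adj state_shift (state_shift x))), state_shift x']).
rewrite shiftK adjP shiftK.
rewrite !Anm_dot !incl_shift [A (pow A k _)](powSr A k).
by rewrite [RHS]adjP shift_pow_adj.
Qed.

End Shift.

(** * Induction along the Schur algorithm *)

Section Induction.
Context {R : realType}.
Local Notation C := R[i].
Variables (M N H : hilbertType C) (Th : C -> {bop M -> N}) (s : system M N H).
Hypothesis s_cons : conservative s.
Hypothesis s_simple : simple_system s.
Hypothesis s_transfer : has_transfer s Th.
Local Notation A := (sysA s).

Let A1 : contractive A := cons_contrA s_cons.

(* [t] is the system tau_n^(0); the other tau_n^(k) are its transports.       *)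
Definition schur_realization n
    (t : system (schur_in Th n) (schur_out Th n) (Hnm A n 0)) :=
  [/\ [/\ conservative t, simple_system t & has_transfer t (schur_iterate Th n)],
      has_graph (adj (sysB t)) (in_graph Th s n n),
      has_graph (sysC t) (out_graph Th s n n n 0) &
      sysA t = Anm A n 0].

Lemma schur_realization0 : exists t, @schur_realization 0 t.
Proof.
pose U : {bop H -> Hnm A 0 0} := proj _.
have UE x : incl _ (U x) = x by exact: incl_proj.
have UK x : adj U (U x) = x by rewrite adj_proj UE.
have UVK y : U (adj U y) = y by rewrite adj_proj [LHS]proj_incl.
exists (transport s U); split.
- split; first exact: transport_conservative.
  + exact: transport_simple.
  + exact: transport_transfer.
- by move=> x; rewrite /in_graph /= adj_comp adj_proj.
- by move=> x; rewrite /out_graph /= adj_proj.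
- by rewrite /= adj_proj.
Qed.

Section NextStep.
Variable n : nat.

Definition Hnm_incl : {bop Hnm A n.+1 0 -> Hnm A n 0} :=
  proj (Hnm A n 0) ** incl (Hnm A n.+1 0).
Local Notation J := Hnm_incl.

Lemma Hnm_step (x : H) : csub_set (Hnm A n.+1 0) x <->
  [/\ csub_set (Hnm A n 0) x, csub_set (Hnm A n 0) (A x) & `|A x| = `|x|].
Proof.
split=> [/(Hnm_mem n.+1 0 _ A1)[xn _]|[_ /(Hnm_mem n 0 _ A1)[Axn _] Ax]].
  have xn' : `|pow A n x| = `|x| by apply: (@norm_pow_factor _ _ _ 1).
  have x1 : `|A x| = `|x|.
    by apply: (@norm_pow_factor _ _ A n 1 x A1); rewrite addn1.
  split=> //; first exact/(Hnm_mem n 0 _ A1).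
  by apply/(Hnm_mem n 0 _ A1); rewrite -powSr xn x1.
by apply/(Hnm_mem n.+1 0 _ A1); rewrite powSr Axn Ax.
Qed.

Lemma incl_Hnm_incl h : incl _ (J h) = incl _ h.
Proof. by apply: incl_proj; have /Hnm_step[] := csub_valP h. Qed.

Lemma Hnm_inclK h : adj J (J h) = h.
Proof.
by apply: adj_isometryK => z; rewrite -incl_norm incl_Hnm_incl.
Qed.

Lemma Anm_incl_Hnm_incl h : incl _ (Anm A n 0 (J h)) = A (incl _ h).
Proof.
rewrite -incl_Hnm_incl; apply: incl_proj; rewrite incl_Hnm_incl.
by have /Hnm_step[] := csub_valP h.
Qed.

(** By the energy balance, C x = 0 means |A_{n,0} x| = |x|. Since A_{n,0} is A followed by a
    projection, this forces |A x| = |x| and A x in H_{n,0}, that is, x in H_{n+1,0}. *)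
Lemma Hnm_incl_range (t : system (schur_in Th n) (schur_out Th n) (Hnm A n 0)) :
  conservative t -> sysA t = Anm A n 0 ->
  forall x, sysC t x = 0 <-> exists h, x = J h.
Proof.
move=> t_cons tA x; have e := cons_norm_state t_cons x; split=> [Cx|[h xh]].
  have Ax : `|Anm A n 0 x| = `|x|.
    by apply/eqP; rewrite -(@eqrXn2 _ 2)// -tA -e Cx normr0 expr0n add0r.
  have Ax1 : `|A (incl _ x)| = `|incl _ x|.
    apply: le_anti; rewrite A1 /= [leLHS](esym Ax); exact: proj_contractive.
  have Axn : csub_set (Hnm A n 0) (A (incl _ x)).
    have := adjK_of_norm (@proj_contractive _ _ (Hnm A n 0)) (x := A (incl _ x)).
    rewrite adj_proj => <-; first exact: csub_valP.
    by rewrite Ax1 -[RHS]Ax.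
  have xn : csub_set (Hnm A n.+1 0) (incl _ x).
    by apply/Hnm_step; split=> //; exact: csub_valP.
  by exists (csub_in xn); apply: incl_inj; rewrite incl_Hnm_incl.
apply/normr0_eq0/eqP; rewrite -sqrf_eq0 -(inj_eq (addIr (`|sysA t x| ^+ 2))) e add0r.
rewrite tA xh -2!incl_norm incl_Hnm_incl Anm_incl_Hnm_incl.
by have /Hnm_step[_ _ ->] := csub_valP h.
Qed.

Lemma Anm_step : adj J ** Anm A n 0 ** J = Anm A n.+1 0.
Proof.
apply: bop_dotP => x y; rewrite -[LHS]/('[adj J (Anm A n 0 (J x)), y]).
by rewrite adjPl !Anm_dot !incl_Hnm_incl.
Qed.

(** [X] and [Y] are returned on all of H_{n,0}, before restriction to H_{n+1,0}, because Y X^* is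
    then formula (a) for Gamma_{n+1}. *)
Lemma schur_realizationS t : @schur_realization n t ->
  exists (X : {bop Hnm A n 0 -> schur_in Th n.+1})
         (Y : {bop Hnm A n 0 -> schur_out Th n.+1}),
  let t1 := System (Y ** adj X) (Y ** sysA t ** J) (adj J ** adj X)
                   (adj J ** sysA t ** J) in
  [/\ forall h, dinv_in Th n.+1 (adj (sysB s) (incl _ h)) (X h),
      forall h, dinv_out Th n.+1 (sysC s (pow A n (incl _ h))) (Y h) &
      @schur_realization n.+1 t1].
Proof.
move=> [[t_cons t_simple t_tr] tB tC tA].
have [X [Y [BX CY c1 s1 tr1]]] := schur_step_system t_cons t_simple t_tr
  Hnm_inclK (Hnm_incl_range t_cons tA).
have Xin h : dinv_in Th n.+1 (adj (sysB s) (incl _ h)) (X h).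
  by exists (adj (sysB t) h); [exact: tB|rewrite BX].
have Yout h : dinv_out Th n.+1 (sysC s (pow A n (incl _ h))) (Y h).
  by exists (sysC t h); [exact: tC|rewrite CY].
exists X, Y; split=> //; split=> //.
- move=> h; rewrite /in_graph -incl_Hnm_incl.
  have -> : adj (adj J ** adj X) = X ** J by rewrite adj_comp !adjK.
  exact: Xin.
(* On H_{n+1,0} the operator A_{n,0} is A itself; it supplies the extra factor in C A^{n+1}. *)
- move=> h; rewrite /out_graph powSr -Anm_incl_Hnm_incl -tA.
  exact: Yout.
- by rewrite /= tA Anm_step.
Qed.

End NextStep.

Lemma schur_realization_exists n : exists t, @schur_realization n t.
Proof.
elim: n => [|n [t tP]]; first exact: schur_realization0.
by have [X [Y [_ _ t1P]]] := schur_realizationS tP; eexists; exact: t1P.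
Qed.

Lemma realization_param n t : @schur_realization n t -> sysD t = schur_param Th n.
Proof.
by move=> [[_ _ t_tr] _ _ _]; rewrite /schur_param t_tr ?normr0// transfer0.
Qed.

Lemma schur_param_contractive n : contractive (schur_param Th n).
Proof.
have [t tP] := schur_realization_exists n.
by rewrite -(realization_param tP); case: tP => [[t_cons _ _] _ _ _]; exact: cons_contrD.
Qed.

(** Each D_{Gamma_k} is injective on its defect space. Claim (b) ranges over arbitrary points of the
    graph, which are thereby values of the operators. *)
Lemma dinv_in_fun n x y y' : dinv_in Th n x y -> dinv_in Th n x y' -> y = y'.
Proof.
elim: n x y y' => [|n IHn] x y y' /=; first by move=> <- <-.
move=> [z xz zy] [z' xz' zy']; apply: (defect_inj (@schur_param_contractive n)).
by rewrite [LHS]zy [RHS]zy'; exact: IHn xz xz'.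
Qed.

Lemma dinv_out_fun n x y y' : dinv_out Th n x y -> dinv_out Th n x y' -> y = y'.
Proof.
elim: n x y y' => [|n IHn] x y y' /=; first by move=> <- <-.
move=> [z xz zy] [z' xz' zy'].
apply: (defect_inj (adj_contraction (@schur_param_contractive n))).
by rewrite [LHS]zy [RHS]zy'; exact: IHn xz xz'.
Qed.

(** For y = A^k x with x in H_{n,0}, C A^n x = C A^p y; this is how the power in the output map
    drops from n to p. *)
Lemma transport_tau n p k t : n = (p + k)%N -> @schur_realization n t ->
  let tau := transport t (state_shift A n p k) in
  [/\ [/\ conservative tau, simple_system tau & has_transfer tau (schur_iterate Th n)],
      has_graph (sysC tau) (out_graph Th s n p p k),
      forall y, incl _ (sysB tau y) = pow A k (incl _ (sysB t y)) &
      sysA tau = Anm A p k].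
Proof.
move=> npk [[t_cons t_simple t_tr] tB tC tA] tau.
have UK := shiftK A1 npk; have UVK := shiftVK A1 npk; split.
- split; first exact: transport_conservative.
  + exact: transport_simple.
  + exact: transport_transfer.
- move=> y; have [x <-] := shift_surj A1 npk y.
  rewrite /out_graph incl_shift// -powD -npk /= UK; exact: tC.
- by move=> y; rewrite -(incl_shift A1 npk).
- by rewrite /= tA shift_Anm.
Qed.

Lemma conservative_range (M' N' H' : hilbertType C) (t : system M' N' H') :
  conservative t ->
  (forall h, range (defect (sysD t)) (adj (sysB t) h)) /\
  (forall h, range (defect (adj (sysD t))) (sysC t h)).
Proof.
move=> t_cons; have D1 := cons_contrD t_cons; split=> h.
  have [X [_ _ ->]] := defect_factor D1 (cons_norm_in t_cons).
  by exists (incl _ (X h)).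
have [Y [_ _ YE]] := defect_factor (adj_contraction D1) (cons_norm_out t_cons).
by rewrite adjK in YE; rewrite YE; exists (incl _ (Y h)).
Qed.

End Induction.

Local Open Scope complex_scope.

Theorem theorem6p7 (R : realType) (M N H : hilbertType R[i])
    (sepM : separable M) (sepN : separable N) (sepH : separable H)
    (Th : R[i] -> {bop M -> N}) (schurTh : schur_class Th)
    (tau0 : system M N H)
    (simple0 : simple_system tau0) (conservative0 : conservative tau0)
    (transfer0 : has_transfer tau0 Th)
    (n : nat) (n_gt0 : (0 < n)%N) (n_defined : schur_defined Th n) :
  [/\
    exists2 F : {bop Hnm (sysA tau0) n.-1 0 -> schur_in Th n},
      has_graph F (in_graph Th tau0 n n.-1) &
      has_graph (schur_param Th n) (fun y z =>
        out_graph Th tau0 n n.-1 n.-1 0 (adj F y) z),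
    [set y | exists x, in_graph Th tau0 n n x y]
      `<=` range (defect (schur_param Th n)) /\
    [set y | exists x, out_graph Th tau0 n 0 0 n x y]
      `<=` range (defect (adj (schur_param Th n))) &
    exists tau : forall k : 'I_n.+1,
        system (schur_in Th n) (schur_out Th n) (Hnm (sysA tau0) (n - k) k),
      (forall k, [/\ is_tau (tau k), simple_system (tau k),
                     conservative (tau k) &
                     has_transfer (tau k) (schur_iterate Th n)]) /\
      (forall j k, unitarily_similar (tau j) (tau k))].
Proof.
case: n n_gt0 n_defined => // n _ _ /=.
have [t tP] := schur_realization_exists conservative0 simple0 transfer0 n.
have [X [Y [Xin Yout t1P]]] := schur_realizationS conservative0 tP.
set t1 := System _ _ _ _ in t1P.
have paramE : schur_param Th n.+1 = Y ** adj X.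
  by rewrite -(realization_param t1P).
have [[t1_cons t1_simple t1_tr] t1B t1C t1A] := t1P.
have D1 : sysD t1 = schur_param Th n.+1 by rewrite paramE.
split.
(* [X] is the operator whose adjoint occurs in (a), and [Y] is the chain of pseudo-inverses applied
   to C A^n. *)
- exists X; first exact: Xin.
  by rewrite paramE => y; exact: Yout.
(* The inclusion for B^* comes from the realization with k = 0, the one for C, without powers of A,
   from the realization with p = 0. *)
- split=> y [x xy].
    rewrite (dinv_in_fun conservative0 simple0 transfer0 xy (t1B x)) -D1.
    exact: (conservative_range t1_cons).1.
  have [[u_cons _ _] uC _ _] :=
    transport_tau conservative0 (esym (add0n n.+1)) t1P.
  rewrite (dinv_out_fun conservative0 simple0 transfer0 xy (uC x)) -D1.
  exact: (conservative_range u_cons).2.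
- have nk (k : 'I_n.+2) : n.+1 = (n.+1 - k + k)%N by rewrite subnK// -ltnS.
  exists (fun k => transport t1 (state_shift (sysA tau0) n.+1 (n.+1 - k) k)).
  split=> [k|j k].
    have [[u_cons u_simple u_tr] uC uB uA] := transport_tau conservative0 (nk k) t1P.
    split=> //; split=> //; exists (adj (sysB t1)) => // y.
    by rewrite adjK; exact: uB.
  have A1 := cons_contrA conservative0.
  by apply: transport_similar => y; rewrite ?shiftK ?shiftVK.
Qed.
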